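(* Let $M$ be a closed smooth manifold and let $\mathcal{F}$ be a $C^1$-foliation of $M$ with positive codimension. If $\mathcal{F}$ is $CW$-expansive, then $\mathcal{F}$ has positive geometric entropy.
   Context: Closed means compact, connected and without boundary; $M$ is endowed with a Riemannian metric. Foliations: a $p$-dimensional $C^r$-foliation $\mathcal{F}$ of $M$, $\dim M=p+q$, is a decomposition of $M$ into connected $C^r$-manifolds (leaves) such that every point of $M$ has a neighborhood $U$ with a $C^r$ chart $\xi=(\xi',\xi''):U\to\mathbb{R}^p\times\mathbb{R}^q$ (distinguished chart) such that for every leaf $L$ each connected component of $L\cap U$ (plaque) is given by $\xi''=$ constant; $q$ is the codimension. A foliated atlas $\mathcal{A}$ (consisting of distinguished charts $\xi:U_\xi\to\mathbb{R}^p\times\mathbb{R}^q$) is nice if $\{U_\xi\}$ is locally finite, each $\xi(U_\xi)$ is an open cube, and whenever $U_{\xi_1}\cap U_{\xi_2}\ne\emptyset$ there is a distinguished chart $\xi_3$ whose domain contains the closure of $U_{\xi_1}\cup U_{\xi_2}$ and with $\xi_3|_{U_{\xi_1}}=\xi_1$. Nice atlases always exist; the cover $\mathcal{U}=\{U_\xi\}$ is then called a nice cover (finite, since $M$ is compact). For $U\in\mathcal{U}$ let $T_U$ be the space of plaques of $U$, which is $C^r$-diffeomorphic to an open cube of $\mathbb{R}^q$ and is regarded as a submanifold of $M$ transverse to the leaves. The complete transversal is the disjoint union $\mathcal{T}=\bigsqcup_{U\in\mathcal{U}}T_U$, with the Riemannian distance on each $T_U$ and distinct pieces lying at a positive distance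 from each other. The holonomy pseudo-group $\mathcal{G}$ of $\mathcal{F}$ is the pseudo-group on $\mathcal{T}$ generated by the finitely many elementary holonomy maps between $T_U$ and $T_V$ for $U,V\in\mathcal{U}$, $U\cap V\neq\emptyset$ (sending a plaque of $U$ to the plaque of $V$ which meets it, when there is one). Pseudo-groups: a local homeomorphism is a homeomorphism $h:D_h\to R_h$ between open sets. A pseudo-group on $X$ is a family of local homeomorphisms of $X$ containing $\mathrm{Id}_X$, closed under composition ($g\circ h$ whenever $D_g\subset R_h$), inverses and restriction to open sets, and containing every local homeomorphism $g$ for which there is an open cover of $D_g$ on whose members the restrictions of $g$ belong to the family. A set $\Gamma$ generates $\mathcal{G}$ if $\bigcup_{g\in\Gamma}(D_g\cup R_g)=X$ and every $g\in\mathcal{G}$ is, near each point of $D_g$, a composition of elements of $\Gamma$ and inverses of elements of $\Gamma$. $\mathcal{F}$ is $CW$-expansive if its holonomy pseudo-group $\mathcal{G}$ is: there is $\delta>0$ such that for every compact connected $C\subset\mathcal{T}$ with more than one point there is $g\in\mathcal{G}$ with $C\subset D_g$ and $\mathrm{diam}(g(C))>\delta$. Geometric entropy: for a finite generator $G$ of a pseudo-group $\mathcal{G}$, $\#g=k$ means that $k$ is the minimal number of elements of $G$ (or inverses of such) whose composition equals $g$ (on $D_g$). Points $x,y$ are $n$-$\varepsilon$-$G$-separated if there is $g\in\mathcal{G}$ with $x,y\in D_g$, $\#g\le n$, $d(g(x),g(y))>\varepsilon$. $S(n,\varepsilon,G)$ is the maximal cardinality of a set whose distinct points are pairwise $n$-$\varepsilon$-$G$-separated,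 and $h(\mathcal{G},G)=\lim_{\varepsilon\to0}\limsup_{n\to\infty}\frac1n\log S(n,\varepsilon,G)$. Positivity of $h(\mathcal{G},G)$ does not depend on the finite generator (classical). $\mathcal{F}$ has positive geometric entropy if its holonomy pseudo-group does, i.e. $h(\mathcal{G},G)>0$.
   Formalization: Each transversal T_U is required to extend as a C^1 transverse graph across the boundary of its cube; for arbitrary transverse submanifolds T_U, whose Riemannian distance may be wildly distorted near the boundary, the claim fails (minimal linear foliation of the 3-torus). *)

(* Defs.v *)
From HB Require Import structures.
From mathcomp Require Import all_boot all_order all_algebra.
From mathcomp Require Import all_classical all_reals all_analysis.
Set Implicit Arguments.
Unset Strict Implicit.
Unset Printing Implicit Defensive.
Import Order.TTheory GRing.Theory Num.Theory.
Import numFieldNormedType.Exports.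

Local Open Scope classical_set_scope.
Local Open Scope ring_scope.

(* [fwd] and [bwd] are total; only their values on [pdom] and on [pran]
   are meaningful. *)
Record phomeo (X Y : Type) := PHomeo {
  pdom : set X;
  fwd :> X -> Y;
  bwd : Y -> X }.

Definition pran X Y (h : phomeo X Y) : set Y := h @` pdom h.

Definition is_phomeo (X Y : topologicalType) (h : phomeo X Y) : Prop :=
  [/\ open (pdom h), open (pran h),
      forall x, pdom h x -> bwd h (h x) = x,
      forall x, pdom h x -> {for x, continuous h} &
      forall y, pran h y -> {for y, continuous (bwd h)}].

Definition pid X : phomeo X X := PHomeo setT id id.

Definition pinv X Y (h : phomeo X Y) : phomeo Y X := PHomeo (pran h) (bwd h) h.

Definition pcomp X Y Z (g : phomeo Y Z) (h : phomeo X Y) : phomeo X Z :=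
  PHomeo (pdom h `&` h @^-1` pdom g) (g \o h) (bwd h \o bwd g).

Definition prestr X Y (U : set X) (h : phomeo X Y) : phomeo X Y :=
  PHomeo U h (bwd h).

(* [g] is the restriction of [h] to the domain of [g]. *)
Definition prestricts X Y (g h : phomeo X Y) : Prop :=
  pdom g `<=` pdom h /\ forall x, pdom g x -> g x = h x.

(* The second clause says that membership does not depend on the irrelevant
   values outside the domain and the range. *)
Definition pseudogroup (X : topologicalType) (H : set (phomeo X X)) : Prop :=
  (forall h, H h -> is_phomeo h) /\
  (forall g h, H g -> is_phomeo h -> pdom h = pdom g -> prestricts h g ->
     H h) /\
  H (@pid X) /\
  (forall g h, H g -> H h -> pdom g `<=` pran h -> H (pcomp g h)) /\
  (forall h, H h -> H (pinv h)) /\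
  (forall h U, H h -> open U -> U `<=` pdom h -> H (prestr U h)) /\
  (forall g, is_phomeo g ->
     (forall x, pdom g x ->
        exists U, [/\ open U, U x, U `<=` pdom g & H (prestr U g)]) -> H g).

Definition with_inverses X (G : set (phomeo X X)) : set (phomeo X X) :=
  G `|` @pinv X X @` G.

Definition is_word X (G : set (phomeo X X)) (w : seq (phomeo X X)) : Prop :=
  forall i, (i < size w)%N -> with_inverses G (nth (@pid X) w i).

Definition comp_word X (w : seq (phomeo X X)) : phomeo X X :=
  foldr (@pcomp X X X) (@pid X) w.

Definition generates (X : topologicalType) (G H : set (phomeo X X)) : Prop :=
  [/\ G `<=` H,
      \bigcup_(g in G) (pdom g `|` pran g) = setT &
      forall h, H h -> forall x, pdom h x ->
        exists U w, [/\ open U, U x, U `<=` pdom h, is_word G w &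
                        prestricts (prestr U h) (comp_word w)]].

Definition finite_generator (X : topologicalType) (G H : set (phomeo X X)) :=
  finite_set G /\ generates G H.

Section Dynamics.
Context {R : realType} {X : topologicalType}.
Variable d : X -> X -> R.

Definition diam (A : set X) : \bar R :=
  ereal_sup [set (d z.1 z.2)%:E | z in A `*` A].

Definition cw_expansive (H : set (phomeo X X)) : Prop :=
  exists2 delta : R, 0 < delta &
    forall C : set X, compact C -> connected C ->
      (exists x y, [/\ C x, C y & x <> y]) ->
      exists2 h, H h & C `<=` pdom h /\ (delta%:E < diam (h @` C))%E.

Definition word_length_le (G : set (phomeo X X)) (h : phomeo X X) (n : nat) :=
  exists w, [/\ is_word G w, (size w <= n)%N & prestricts h (comp_word w)].

Definition separated_points (H G : set (phomeo X X)) (n : nat) (eps : R) (x y : X) :=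
  exists2 h, H h &
    [/\ pdom h x, pdom h y, word_length_le G h n & eps < d (h x) (h y)].

(* Takes the value +oo when there are arbitrarily large separated sets. *)
Definition sep_card (H G : set (phomeo X X)) (n : nat) (eps : R) : \bar R :=
  ereal_sup [set k%:R%:E | k in [set k : nat |
    exists2 f : 'I_k -> X, injective f &
      forall i j, i != j -> separated_points H G n eps (f i) (f j)]].

Definition entropy (H G : set (phomeo X X)) : \bar R :=
  lim (limn_esup (fun n => (n%:R^-1)%:E * lne (sep_card H G n eps))%E
       @[eps --> 0^'+]).

(* Positivity of [entropy H G] is a property of [H] alone, so it is asked of
   every finite generator, at least one of which must exist. *)
Definition positive_entropy (H : set (phomeo X X)) : Prop :=
  (exists G, finite_generator G H) /\
  forall G, finite_generator G H -> (0 < entropy H G)%E.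

End Dynamics.

(* To be used with [U] open. *)
Fixpoint Ck {R : realType} {V W : normedModType R} (k : nat) (U : set V)
    (f : V -> W) : Prop :=
  if k is k'.+1 then
    (forall x, U x -> differentiable f x) /\
    (forall v, Ck k' U (fun x => 'D_v f x))
  else forall x, U x -> {for x, continuous f}.

Section Manifolds.
Context {R : realType}.

Definition Ck_compatible (X : topologicalType) n (k : nat)
    (phi psi : phomeo X 'rV[R]_n) : Prop :=
  Ck k (phi @` (pdom phi `&` pdom psi)) (psi \o bwd phi) /\
  Ck k (psi @` (pdom phi `&` pdom psi)) (phi \o bwd psi).

(* The atlas is indexed by the points of the manifold: [chart x] is a chart
   around [x]. *)
Definition Ck_manifold (k n : nat) (N : topologicalType)
    (chart : N -> phomeo N 'rV[R]_n) : Prop :=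
  [/\ hausdorff_space N, @second_countable N,
      forall x, is_phomeo (chart x) /\ pdom (chart x) x &
      forall x y, Ck_compatible k (chart x) (chart y)].

Definition closed_smooth_manifold (n : nat) (M : topologicalType)
    (chart : M -> phomeo M 'rV[R]_n) : Prop :=
  [/\ forall k, Ck_manifold k chart, compact [set: M], connected [set: M] &
      [set: M] !=set0].

(* [g x] is the Gram matrix of the metric in the chart [chart x], as a function
   of the coordinates. *)
Definition riemannian_metric n (M : topologicalType)
    (chart : M -> phomeo M 'rV[R]_n) (g : M -> 'rV[R]_n -> 'M[R]_n) : Prop :=
  [/\ forall x k, Ck k (pran (chart x)) (g x),
      forall x a, pran (chart x) a -> (g x a)^T = g x a,
      forall x a, pran (chart x) a ->
        forall v : 'rV[R]_n, v != 0 -> 0 < (v *m g x a *m v^T) 0 0 &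
      forall x y z, pdom (chart x) z -> pdom (chart y) z ->
        let D := 'd (chart y \o bwd (chart x)) (chart x z) in
        forall u v : 'rV[R]_n,
          u *m g x (chart x z) *m v^T =
          D u *m g y (chart y z) *m (D v)^T].

Definition injectively_immersed (k m n : nat) (M : topologicalType)
    (chart : M -> phomeo M 'rV[R]_n) (N : topologicalType)
    (chartN : N -> phomeo N 'rV[R]_m) (f : N -> M) : Prop :=
  [/\ injective f, continuous f,
      forall x y, Ck k
        (chartN x @` (pdom (chartN x) `&` f @^-1` pdom (chart y)))
        (chart y \o f \o bwd (chartN x)) &
      forall x, injective
        ('d (chart (f x) \o f \o bwd (chartN x)) (chartN x x))].

Section Foliations.
Variables (p q : nat) (M : topologicalType).
Variable chart : M -> phomeo M 'rV[R]_(p + q).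

Definition leaf_submanifold (k : nat) (L : set M) : Prop :=
  exists (N : topologicalType) (chartN : N -> phomeo N 'rV[R]_p) (f : N -> M),
    [/\ Ck_manifold k chartN, connected [set: N],
        injectively_immersed k chart chartN f & range f = L].

(* [lsubmx \o xi] and [rsubmx \o xi] are the components of [xi] in R^p and
   R^q; connected components are for the topology induced by that of [M]. *)
Definition distinguished (k : nat) (F : set (set M))
    (xi : phomeo M 'rV[R]_(p + q)) : Prop :=
  [/\ is_phomeo xi,
      forall x, Ck_compatible k (chart x) xi &
      forall L x, F L -> L x -> pdom xi x ->
        exists c : 'rV[R]_q, connected_component (L `&` pdom xi) x =
          [set y | pdom xi y /\ rsubmx (xi y) = c]].

Definition foliation (k : nat) (F : set (set M)) : Prop :=
  [/\ \bigcup_(L in F) L = setT,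
      forall L L', F L -> F L' -> L `&` L' !=set0 -> L = L',
      forall L, F L -> L !=set0 /\ leaf_submanifold k L &
      forall x, exists2 xi, distinguished k F xi & pdom xi x].

Variables (I : finType) (xi : I -> phomeo M 'rV[R]_(p + q)).

(* The norm on row vectors is the sup norm, so that its balls are cubes. *)
Definition nice_atlas (k : nat) (F : set (set M)) : Prop :=
  [/\ forall i, distinguished k F (xi i),
      \bigcup_i pdom (xi i) = setT,
      forall i, exists a r, 0 < r /\ pran (xi i) = ball a r &
      forall i j, pdom (xi i) `&` pdom (xi j) !=set0 ->
        exists2 xi3, distinguished k F xi3 &
          closure (pdom (xi i) `|` pdom (xi j)) `<=` pdom xi3 /\
          forall x, pdom (xi i) x -> xi3 x = xi i x].

(* The plaque rsubmx (xi i x) = c of the i-th domain is represented by c. *)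
Definition plaque_space (i : I) : set 'rV[R]_q :=
  [set rsubmx (xi i x) | x in pdom (xi i)].

Definition complete_transversal : topologicalType :=
  {i : I & set_type (plaque_space i)}.

Definition plaque (t : complete_transversal) : set M :=
  [set x | pdom (xi (projT1 t)) x /\
           rsubmx (xi (projT1 t) x) = set_val (projT2 t)].

Definition elementary_holonomy (i j : I)
    (h : phomeo complete_transversal complete_transversal) : Prop :=
  [/\ is_phomeo h,
      pdom h = [set t | projT1 t = i /\ plaque t `&` pdom (xi j) !=set0] &
      forall t, pdom h t ->
        projT1 (h t) = j /\ plaque t `&` plaque (h t) !=set0].

Definition elementary_holonomies :
    set (phomeo complete_transversal complete_transversal) :=
  [set h | exists i j,
    pdom (xi i) `&` pdom (xi j) !=set0 /\ elementary_holonomy i j h].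

Definition holonomy_pseudogroup
    (H : set (phomeo complete_transversal complete_transversal)) : Prop :=
  pseudogroup H /\ generates elementary_holonomies H.

Variable sigma : I -> 'rV[R]_q -> 'rV[R]_p.

(* A submanifold transverse to the leaves which meets each plaque of the i-th
   domain once is the graph {xi' = sigma i xi''}. It is required to extend
   across the boundary of the cube: otherwise the induced distance could be
   arbitrarily distorted near that boundary. *)
Definition transverse_sections : Prop :=
  forall i,
    (forall c, plaque_space i c -> pran (xi i) (row_mx (sigma i c) c)) /\
    exists W, [/\ open W, closure (plaque_space i) `<=` W & Ck 1 W (sigma i)].

Definition section (i : I) (c : 'rV[R]_q) : M :=
  bwd (xi i) (row_mx (sigma i c) c).

Variable g : M -> 'rV[R]_(p + q) -> 'M[R]_(p + q).

Definition speed (gamma : R -> M) (t : R) : R :=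
  let phi := chart (gamma t) in
  let v : 'rV[R]_(p + q) := 'D_1 (phi \o gamma : R^o -> _) t in
  Num.sqrt ((v *m g (gamma t) (phi (gamma t)) *m v^T) 0 0).

Definition curve_length (i : I) (c : R -> 'rV[R]_q) : R :=
  \int[lebesgue_measure]_(t in `[0, 1]) speed (section i \o c) t.

Definition C1_curve (i : I) (c : R -> 'rV[R]_q) : Prop :=
  (exists W : set R^o, [/\ open W, `[0, 1] `<=` W & Ck 1 W (c : R^o -> _)]) /\
  (forall t, 0 <= t <= 1 -> plaque_space i (c t)).

(* A piecewise C^1 path is a sequence of C^1 pieces parametrized by [0, 1]. *)
Fixpoint piecewise_path (i : I) (y z : 'rV[R]_q) (s : seq (R -> 'rV[R]_q)) :=
  if s is c :: s' then
    [/\ C1_curve i c, c 0 = y & piecewise_path i (c 1) z s']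
  else y = z.

Definition riemannian_dist (i : I) (y z : 'rV[R]_q) : R :=
  inf [set \sum_(c <- s) curve_length i c | s in piecewise_path i y z].

Definition transversal_dist
    (d : complete_transversal -> complete_transversal -> R) : Prop :=
  [/\ [/\ forall s t, d s t = 0 <-> s = t,
          forall s t, d s t = d t s &
          forall s t u, d s u <= d s t + d t u],
      forall i (y z : plaque_space i),
        d (existT _ i y : complete_transversal)
          (existT _ i z : complete_transversal) =
        riemannian_dist i (set_val y) (set_val z) &
      exists2 kappa : R, 0 < kappa &
        forall s t, projT1 s <> projT1 t -> kappa <= d s t].

End Foliations.
End Manifolds.

Arguments holonomy_pseudogroup {R p q M I} xi H.
Arguments transversal_dist {R p q M} chart {I} xi sigma g d.

(* Main.v *)
Require Import Defs.
From HB Require Import structures.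
From mathcomp Require Import all_boot all_order all_algebra.
From mathcomp Require Import all_classical all_reals all_analysis.
From mathcomp Require Import ring lra.
Set Implicit Arguments.
Unset Strict Implicit.
Unset Printing Implicit Defensive.
Import Order.TTheory GRing.Theory Num.Theory.
Import numFieldNormedType.Exports.
Import Defs.
Local Open Scope classical_set_scope.
Local Open Scope ring_scope.

(** CW-expansivity provides, for each nondegenerate continuum C, an element h of
    the pseudogroup H that enlarges C to a diameter above a fixed delta. The
    obstacle on the way to entropy is that H is closed under gluing: near
    different points of C the map h agrees with different words in the
    generators, possibly with no common domain, so that h says nothing directly
    about separation of two points by one word.

    The way around it is that finitely many such h are enough. The continua of
    diameter at least eps inside a compact set form a compact family, and one h
    enlarges all the continua near a given one ([uniform_expansion], by
    ultrafilter limits of continua). These finitely many maps act as additional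
    letters of length one. A given h agrees near each point with a word, so on a
    compact set a Lebesgue number yields a bound N on the length and a scale
    below which two points are moved by one common word ([generated_tracked]).
    Two points that are separated by a product of n of these letters are thus
    separated by a word of length at most n * N, at a smaller but fixed scale:
    at the first time when they are further apart than that scale, they have
    moved by a common word so far.

    The transversal is a union of open cubes and is not compact, so an enlarged
    continuum has to be brought back to a fixed compact set ([recurrent]). Every
    limit of plaques of a chart domain passes through the interior of some other
    chart domain, because M is compact, and niceness of the atlas extends the
    corresponding elementary holonomy injectively to a compact neighbourhood of
    the limit ([extended_holonomy]); a continuum that crosses this neighbourhood
    keeps a definite size. Here sizes are measured by the Riemannian distance,
    which is at most a constant times the distance of coordinates, uniformly up
    to the boundary of the cubes ([dist_lipschitz]).

    The horseshoe is now immediate. Call a continuum a state if one of the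
    finitely many letters enlarges it. The image of a state contains two distant
    subcontinua ([split_continuum], by boundary bumping), and each of them has a
    piece whose return to the compact set is again a state. After n steps this
    gives 2 ^ n points, pairwise separated by words of length at most n * N, so
    that the entropy is at least ln 2 / N whatever the generator ([horseshoe],
    [exponentially_many_separated], [entropy_ge]). The finite generator itself
    consists of one elementary holonomy for each ordered pair of chart domains
    that intersect ([holonomy_finite_generator]). *)

(** * Compactness, continua and boundary bumping *)

Section General.

Lemma near_finite_set (T J : Type) (S : set T) (F : set_system J)
    (P : J -> T -> Prop) {FF : Filter F} : finite_set S ->
  (forall t, S t -> \forall j \near F, P j t) ->
  \forall j \near F, forall t, S t -> P j t.
Proof.
move=> /(@finite_seqP {classic T})[s ->].
elim: s => [|t s IH] H; first exact: nearW.
have Ht : \forall j \near F, P j t by apply: H; rewrite /= inE eqxx.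
have Hs : \forall j \near F, forall u, [set` s] u -> P j u.
  by apply: IH => u us; apply: H; rewrite /= inE [u \in s]us orbT.
near=> j => u /=; rewrite inE => /orP[/eqP ->|us].
  by near: j.
have := near Hs j; apply => //.
Unshelve. all: by end_near. Qed.

(** A property of sets that is local, hereditary and stable under finite unions
    passes to compact sets. This is the form in which finite families of maps are
    extracted below: such a property typically says that some finite family
    handles all the points of the set. *)
Lemma compact_induction (X : topologicalType) (K : set X)
    (P : set X -> Prop) : compact K -> P set0 ->
  (forall A B, P A -> P B -> P (A `|` B)) ->
  (forall A B, A `<=` B -> P B -> P A) ->
  (forall x, K x -> exists2 V, nbhs x V & P V) -> P K.
Proof.
move=> cK P0 PU Ps Pl.
have FF : Filter [set A | exists2 B : set X, P B & ~` B `<=` A].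
  split; first by exists set0.
  - move=> A B [A' PA A'A] [B' PB B'B]; exists (A' `|` B'); first exact: PU.
    by rewrite setCU => x [] *; split; [apply: A'A|apply: B'B].
  - by move=> A B AB [A' PA A'A]; exists A' => // x /A'A/AB.
pose F := [set A | exists2 B : set X, P B & ~` B `<=` A].
have [] := (compact_near_coveringP K).1 cK X F (fun i x => i <> x) FF.
  move=> x /Pl[V Vx PV]; exists (V, ~` V); first by split => //; exists V.
  by move=> [y i]/= [Vy +] iy; rewrite iy; apply.
move=> B PB KB; apply: Ps PB => x Kx; apply: contrapT => nBx.
by have /(_ x Kx) := KB x nBx.
Qed.

Lemma closed_connected (X : topologicalType) (A : set X) : closed A ->
  (forall P Q, closed P -> closed Q -> P `|` Q = A -> P `&` Q = set0 ->
     P = set0 \/ Q = set0) -> connected A.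
Proof.
move=> cA H B B0 [C oC BC] [D cD BD].
have cB : closed B by rewrite BD; exact: closedI.
have cN : closed (A `\` B).
  suff -> : A `\` B = A `&` ~` C by apply: closedI => //; exact: open_closedC.
  rewrite BC; apply/seteqP; split=> x [Ax] nx; split=> //.
    by move=> Cx; apply: nx.
  by case.
have [||B0'|AB0] := H B (A `\` B) cB cN.
- by rewrite setDUK// BD; exact: subIsetl.
- by rewrite setDIK.
- by move: B0; rewrite B0' => -[].
- apply/seteqP; split; first by rewrite BD; exact: subIsetl.
  by move=> x Ax; apply: contrapT => Bx; have : (A `\` B) x by []; rewrite AB0.
Qed.

Lemma connected_closed_split (X : topologicalType) (C P Q : set X) :
  connected C -> closed P -> closed Q -> C `<=` P `|` Q ->
  C `&` P `&` Q = set0 -> C `&` P !=set0 -> C `<=` P.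
Proof.
move=> cC cP cQ CPQ PQ0 CP0.
suff : C `&` P = C by move=> <-; exact: subIsetr.
apply: cC => //; last by exists P.
exists (~` Q); first exact: closed_openC.
apply/seteqP; split=> x [Cx H]; split=> //.
  by move=> Qx; have : (C `&` P `&` Q) x by []; rewrite PQ0.
by have [|/H] := CPQ x Cx.
Qed.

End General.

Section MetricTopology.
Variables (R : realType) (X : topologicalType) (d : X -> X -> R).

(** Each [d s] is continuous and d vanishes only on the diagonal, which forces d to
    induce the given topology on every compact set; all the estimates below take
    place on compact sets. *)
Definition topological_metric :=
  [/\ forall s t, d s t = 0 <-> s = t, forall s t, d s t = d t s,
      forall s t u, d s u <= d s t + d t u &
      forall s e, 0 < e -> \forall t \near s, d s t < e].

Hypothesis dm : topological_metric.

Lemma dist_refl s : d s s = 0. Proof. by case: dm => H _ _ _; apply/H. Qed.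
Lemma dist_sym s t : d s t = d t s. Proof. by case: dm. Qed.
Lemma dist_tri s t u : d s u <= d s t + d t u. Proof. by case: dm. Qed.
Lemma dist_near s e : 0 < e -> \forall t \near s, d s t < e.
Proof. by case: dm => _ _ _; apply. Qed.

Lemma dist_ge0 s t : 0 <= d s t.
Proof. by have := dist_tri s t s; rewrite dist_refl (dist_sym t s); lra. Qed.

Lemma dist_gt0 s t : s <> t -> 0 < d s t.
Proof.
move=> st; rewrite lt_def dist_ge0 andbT; apply/eqP => h; apply: st.
by case: dm => H _ _ _; exact/H.
Qed.

Lemma near_gt_dist s t r : r < d s t ->
  \forall s' \near s & t' \near t, r < d s' t'.
Proof.
move=> rd; have e0 : 0 < (d s t - r) / 2 by lra.
near=> s' t'.
have h1 : d s s' < (d s t - r) / 2 by near: s'; exact: dist_near.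
have h2 : d t t' < (d s t - r) / 2 by near: t'; exact: dist_near.
have := dist_tri s s' t; have := dist_tri s' t' t; rewrite (dist_sym t' t).
lra.
Unshelve. all: by end_near. Qed.

Lemma open_dist_gt s r : open [set t : X | r < d s t].
Proof.
rewrite openE => t /= /near_gt_dist [[A B] /= [As Bt]] H.
apply: filterS Bt => t' Bt'; apply: (H (s, t')); split => //=.
exact: nbhs_singleton.
Qed.

Lemma open_dist_lt s r : open [set t : X | d s t < r].
Proof.
rewrite openE => t /= dr; have e0 : 0 < r - d s t by lra.
apply: filterS (dist_near t e0) => t' /= h.
by have := dist_tri s t t'; lra.
Qed.

Lemma closed_dist_le s r : closed [set t : X | d s t <= r].
Proof.
rewrite -openC; suff -> : ~` [set t : X | d s t <= r] = [set t : X | r < d s t].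
  exact: open_dist_gt.
by apply/seteqP; split=> t /=; rewrite ltNge => /negP.
Qed.

Lemma metric_hausdorff : hausdorff_space X.
Proof.
move=> s t cl; apply: contrapT => /dist_gt0/near_gt_dist [[A B] /= [As Bt]] H.
have [x [Ax Bx]] := cl _ _ As Bt.
by have := H (x, x) (conj Ax Bx); rewrite /= dist_refl ltxx.
Qed.

Lemma metric_compact_closed (K : set X) : compact K -> closed K.
Proof. by apply: compact_closed; exact: metric_hausdorff. Qed.

(** The distance is jointly continuous and positive off the diagonal, hence bounded
    below on the product of two disjoint compact sets. Lower bounds on distances
    all come from this lemma. *)
Lemma compact_gap (A B : set X) : compact A -> compact B -> A `&` B = set0 ->
  exists2 e, 0 < e & forall a b, A a -> B b -> e <= d a b.
Proof.
move=> cA cB AB0; near ((0:R)^'+) => e; exists e => //.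
move=> a b Aa Bb; move: a Aa b Bb; near: e.
apply: ((compact_near_coveringP A).1 cA R _ (fun e a => forall b, B b -> e <= d a b)).
move=> a Aa.
have FF : Filter (filter_prod (nbhs a) ((0:R)^'+)) by exact: filter_prod_filter.
suff : \forall p \near filter_prod (nbhs a) ((0:R)^'+), B `<=` (fun b => p.2 <= d p.1 b) by [].
apply: ((compact_near_coveringP B).1 cB _ _ (fun p b => p.2 <= d p.1 b)) => b Bb.
have ab : 0 < d a b.
  apply: dist_gt0 => ab; have : (A `&` B) a by split=> //; rewrite ab.
  by rewrite AB0.
have : d a b / 2 < d a b by lra.
move=> /near_gt_dist [[V W] /= [Va Wb]] H.
exists (W, V `*` [set e | e < d a b / 2]) => /=.
  split => //; exists (V, [set e | e < d a b / 2]); last by move=> [].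
  by split => //=; apply: nbhs_right_lt; lra.
by move=> [b' [a' e']] /= [Wb' [Va' e'd]]; have := H (a', b') (conj Va' Wb') => /=; lra.
Unshelve. all: by end_near. Qed.

Lemma separate_compact (A B : set X) : compact A -> compact B -> A `&` B = set0 ->
  exists U1 U2, [/\ open U1, open U2, A `<=` U1, B `<=` U2 & U1 `&` U2 = set0].
Proof.
move=> cA cB /(compact_gap cA cB)[e e0 H].
exists (\bigcup_(a in A) [set t | d a t < e / 2]),
       (\bigcup_(a in B) [set t | d a t < e / 2]); split.
- by apply: bigcup_open => a _; exact: open_dist_lt.
- by apply: bigcup_open => a _; exact: open_dist_lt.
- by move=> a Aa; exists a => //=; rewrite dist_refl; lra.
- by move=> a Aa; exists a => //=; rewrite dist_refl; lra.
- apply/seteqP; split => // x [[a Aa /= ax] [b Bb /= bx]].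
  by have := H a b Aa Bb; have := dist_tri a x b; rewrite (dist_sym x b); lra.
Qed.

Section Bumping.
Variables (Z : set X) (x : X).
Hypotheses (cZ : compact Z) (Zx : Z x).

(* Clopen subsets of Z are described by closed subsets of X, as Z is compact. *)
Let split_off F := [/\ F `<=` Z, closed F, closed (Z `\` F) & F x].
Let Q := [set y | Z y /\ forall F, split_off F -> F y].

Let Qclosed : closed Q.
Proof.
rewrite (_ : Q = Z `&` \bigcap_(F in split_off) F); last first.
  by apply/seteqP; split=> y [].
apply: closedI; first exact: metric_compact_closed.
by apply: closed_bigI => F [].
Qed.

Let Qx : Q x. Proof. by split=> // F []. Qed.

Let Q_open O : open O -> Q `<=` O -> exists2 F, split_off F & F `<=` O.
Proof.
move=> oO QO.
suff [F sF FA] : exists2 F, split_off F & F `&` (Z `&` ~` O) = set0.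
  exists F => // y Fy; apply: contrapT => Oy.
  have [FZ _ _ _] := sF.
  have : (F `&` (Z `&` ~` O)) y by split=> //; split=> //; exact: FZ.
  by rewrite FA.
have sZ : split_off Z.
  by split=> //; [exact: metric_compact_closed|rewrite setDv; exact: closed0].
apply: (@compact_induction X (Z `&` ~` O) (fun A => exists2 F, split_off F & F `&` A = set0)).
- by apply: compact_closedI => //; exact: open_closedC.
- by exists Z => //; rewrite setI0.
- move=> A B [F [FZ cF cZF Fx] FA] [G [GZ cG cZG Gx] GB]; exists (F `&` G).
    split=> //; [by move=> y [/FZ]|exact: closedI|].
    by rewrite setDIr; exact: closedU.
  rewrite setIUr; apply/seteqP; split=> // y [[[Fy Gy] Ay]|[[Fy Gy] By]].
    by rewrite -FA.
  by rewrite -GB.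
- move=> A B AB [F sF FB]; exists F => //; apply/seteqP; split=> // y [Fy /AB By].
  by rewrite -FB.
- move=> y [Zy Oy].
  have /existsNP[F /not_implyP[sF Fy]] : ~ forall F, split_off F -> F y.
    by move=> H; apply: Oy; apply: QO.
  have [_ cF _ _] := sF.
  exists (~` F); first by apply: open_nbhs_nbhs; split=> //; exact: closed_openC.
  by exists F => //; rewrite setICr.
Qed.

Let Qconnected : connected Q.
Proof.
apply: closed_connected => // P P' cP cP' PPQ PP0.
have QZ : Q `<=` Z by move=> y [].
have cptQ (A : set X) : closed A -> A `<=` Q -> compact A.
  by move=> cA AQ; apply: subclosed_compact cZ _ => //; exact: subset_trans QZ.
have PQ : P `<=` Q by rewrite -PPQ; exact: subsetUl.
have P'Q : P' `<=` Q by rewrite -PPQ; exact: subsetUr.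
have [U1 [U2 [oU1 oU2 PO P'O U120]]] := separate_compact (cptQ _ cP PQ) (cptQ _ cP' P'Q) PP0.
have QO : Q `<=` U1 `|` U2.
  by rewrite -PPQ => y [/PO|/P'O]; [left|right].
have [F [FZ cF cZF Fx] FO] := Q_open (openU oU1 oU2) QO.
have key (A B : set X) : open A -> open B -> A `&` B = set0 -> F `<=` A `|` B -> A x ->
    Q `<=` A.
  move=> oA oB AB0 FAB Ax y [Zy]; move=> /(_ (F `&` A)) []//; split=> //.
  - by move=> z [/FZ].
  - suff -> : F `&` A = F `&` ~` B by apply: closedI => //; exact: open_closedC.
    apply/seteqP; split=> z [Fz H]; split=> //.
      by move=> Bz; have : (A `&` B) z by []; rewrite AB0.
    by have [] := FAB z Fz.
  - rewrite setDIr; apply: closedU => //.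
    suff -> : Z `\` A = Z `&` ~` A.
      by apply: closedI; [exact: metric_compact_closed|exact: open_closedC].
    by rewrite setDE.
have : P x \/ P' x by have := Qx; rewrite -{1}PPQ.
case=> [/PO Ox|/P'O Ox].
- right; apply/seteqP; split=> // y P'y.
  have : (U1 `&` U2) y; last by rewrite U120.
  by split; [apply: (key _ _ oU1 oU2 U120 FO Ox); exact: P'Q|exact: P'O].
- left; apply/seteqP; split=> // y Py.
  have : (U1 `&` U2) y; last by rewrite U120.
  split; [exact: PO|apply: (key _ _ oU2 oU1 _ _ Ox); last exact: PQ].
    by rewrite setIC.
  by rewrite setUC.
Qed.

(** In a compact Hausdorff space the quasicomponent of x, the intersection of the
    clopen sets containing x, is connected: were it the union of two disjoint
    compact pieces, separated by open sets, then by compactness some clopen set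
    would lie in the union of these open sets, and half of it would be a clopen
    set that misses one of the pieces. *)
Lemma quasicomponent_connected : exists C',
  [/\ compact C', connected C', C' `<=` Z, C' x &
      forall O, open O -> C' `<=` O -> exists F,
        [/\ closed F, closed (Z `\` F), F x & F `<=` Z `&` O]].
Proof.
have QZ : Q `<=` Z by move=> y [].
exists Q; split=> //; first exact: subclosed_compact QZ.
move=> O oO QO; have [F [FZ cF cZF Fx] FO] := Q_open oO QO.
by exists F; split=> //; move=> y Fy; split; [exact: FZ|exact: FO].
Qed.

End Bumping.

(** A quasicomponent of C in B that stayed inside O would be surrounded, within O,
    by a clopen subset of the trace of C on B; this subset would then be clopen in
    C as well, against the connectedness of C. *)
Lemma boundary_bumping (C O B : set X) x : compact C -> connected C -> open O ->
  closed B -> O `<=` B -> C x -> O x -> ~ C `<=` O ->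
  exists C', [/\ compact C', connected C', C' `<=` C `&` B, C' x & ~ C' `<=` O].
Proof.
move=> kC cC oO cB OB Cx Ox nCO.
have cZ : compact (C `&` B) by exact: compact_closedI.
have [C' [kC' cC' C'Z C'x H]] := quasicomponent_connected cZ (conj Cx (OB _ Ox)).
exists C'; split=> // C'O; apply: nCO.
have [F [cF cZF Fx FZO]] := H O oO C'O.
suff CF : C `<=` F by move=> y /CF/FZO[].
apply: (@connected_closed_split _ _ _ ((C `&` B) `\` F `|` (C `&` ~` O)) cC cF).
- by apply: closedU => //; apply: closedI; [exact: metric_compact_closed|exact: open_closedC].
- move=> y Cy; have [Fy|nFy] := pselect (F y); [by left|right].
  have [yO|nyO] := pselect (O y); [left|by right].
  by split=> //; split=> //; exact: OB.
- apply/seteqP; split=> // y [[Cy Fy] [[]//|[_ nO]]].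
  by apply: nO; have [] := FZO _ Fy.
- by exists x.
Qed.

End MetricTopology.

(** * Lebesgue numbers, words and expansion of continua *)

Section Lebesgue.
Variables (R : realType) (X : topologicalType) (d : X -> X -> R).
Hypothesis dm : topological_metric d.

Lemma closed_dist_ge s r : closed [set t : X | r <= d s t].
Proof.
rewrite -openC; suff -> : ~` [set t : X | r <= d s t] = [set t : X | d s t < r].
  exact: open_dist_lt.
by apply/seteqP; split=> t /=; rewrite ltNge => /negP.
Qed.

(** On a compact set the metric balls around a point are eventually inside any
    given topological neighbourhood. *)
Lemma compact_dist_nbhs (K W : set X) x : compact K -> nbhs x W ->
  exists2 r, 0 < r & forall y, K y -> d x y < r -> W y.
Proof.
move=> cK; rewrite nbhsE => -[V [oV Vx] VW].
have c1 : compact (K `&` ~` V) by apply: compact_closedI => //; exact: open_closedC.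
have [|r r0 H] := compact_gap dm (@compact_set1 X x) c1.
  by apply/seteqP; split=> // y [-> [_ /(_ Vx)]].
exists r => // y Ky dxy; apply: VW; apply: contrapT => nVy.
by have := H x y erefl (conj Ky nVy); lra.
Qed.

(** Lebesgue number lemma, with a second parameter p.2 along a filter: it serves
    for uniform continuity, and with F the filter of large integers for a uniform
    bound on the length of words. *)
Lemma lebesgue_near (I : Type) (F : set_system I) (P : I -> X -> X -> Prop)
    (K : set X) : Filter F -> compact K ->
  (forall x, K x -> exists2 W, nbhs x W &
     \forall i \near F, forall y z, W y -> W z -> P i y z) ->
  \forall p \near filter_prod ((0:R)^'+) F,
    forall y, K y -> forall z, K z -> d y z < p.1 -> P p.2 y z.
Proof.
move=> FF cK H.
have FR : Filter (filter_prod ((0:R)^'+) F) by exact: filter_prod_filter.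
suff : \forall p \near filter_prod ((0:R)^'+) F,
   K `<=` (fun y => K y -> forall z, K z -> d y z < p.1 -> P p.2 y z).
  by apply: filterS => p h y Ky; exact: h.
apply: ((compact_near_coveringP K).1 cK _ _
  (fun p y => K y -> forall z, K z -> d y z < p.1 -> P p.2 y z)) => x Kx.
have [W Wx HW] := H x Kx.
have [r r0 Hr] := compact_dist_nbhs cK Wx.
have r20 : 0 < r / 2 by lra.
exists ([set y | d x y < r / 2],
  [set e | e < r / 2] `*` [set i | forall y z, W y -> W z -> P i y z]).
  split; first exact: dist_near.
  exists ([set e | e < r / 2], [set i | forall y z, W y -> W z -> P i y z]) => //.
  by split => //=; exact: nbhs_right_lt.
move=> [y [e i]] /= [dxy [er Pi]] Ky z Kz dyz; apply: Pi; apply: Hr => //.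
  by lra.
by have := dist_tri dm x y z; lra.
Qed.

End Lebesgue.

Section Pseudogroups.
Variables (X : topologicalType) (H : set (phomeo X X)).
Hypothesis pH : pseudogroup H.

Lemma pseudogroup_phomeo h : H h -> is_phomeo h.
Proof. by case: pH => + _; apply. Qed.

Lemma pseudogroup_id : H (@pid X).
Proof. by case: pH => _ [_ []]. Qed.

Lemma pseudogroup_inv h : H h -> H (pinv h).
Proof. by case: pH => _ [_ [_ [_ []]]] + _; apply. Qed.

(** The axiom of composition asks for the domain of g to lie in the range of h;
    restricting g to this range first does not change the composite. *)
Lemma pseudogroup_comp g h : H g -> H h -> H (pcomp g h).
Proof.
move=> Hg Hh; have [_ [_ [_ [Hcomp [_ [Hrestr _]]]]]] := pH.
have [og _ _ _ _] := pseudogroup_phomeo Hg.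
have [_ oh _ _ _] := pseudogroup_phomeo Hh.
have Hg' := Hrestr g _ Hg (openI og oh) (@subIsetl _ _ _).
have := Hcomp _ _ Hg' Hh (@subIsetr _ _ _).
rewrite /pcomp /=; set A := (A in PHomeo A _ _); set B := (B in _ -> H (PHomeo B _ _)).
suff -> : A = B by [].
apply/seteqP; split=> x /=; first by case=> hx [].
by case=> hx gx; split=> //; split=> //; exists x.
Qed.

Lemma is_word_cons (G : set (phomeo X X)) l w :
  is_word G (l :: w) <-> with_inverses G l /\ is_word G w.
Proof.
split=> [W|[Gl W] [|i]//]; last exact: W.
by split; [exact: (W 0%N)|move=> i iw; exact: (W i.+1)].
Qed.

Lemma is_word_cat (G : set (phomeo X X)) v w :
  is_word G v -> is_word G w -> is_word G (v ++ w).
Proof.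
elim: v => //= l v IH /is_word_cons[Gl Gv] Gw.
by apply/is_word_cons; split => //; exact: IH.
Qed.

Lemma comp_word_cat v w x :
  (pdom (comp_word (v ++ w)) x <->
   pdom (comp_word w) x /\ pdom (comp_word v) (comp_word w x)) /\
  comp_word (v ++ w) x = comp_word v (comp_word w x) :> X.
Proof.
elim: v => [|l v [IH1 IH2]] /=; first by split=> //; split=> [|[]].
split; last by rewrite IH2.
rewrite /setI/= IH2; split.
  by move=> [/IH1[? ?] ?].
by move=> [? [? ?]]; split=> //; exact/IH1.
Qed.

Lemma pseudogroup_word (G : set (phomeo X X)) w :
  G `<=` H -> is_word G w -> H (comp_word w).
Proof.
move=> GH; elim: w => [|l w IH] /=; first by move=> _; exact: pseudogroup_id.
move=> /is_word_cons[Gl Gw]; apply: pseudogroup_comp; last exact: IH.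
by case: Gl => [/GH//|[g /GH Hg <-]]; exact: pseudogroup_inv.
Qed.

Lemma phomeo_continuum (h : phomeo X X) C : is_phomeo h -> C `<=` pdom h ->
  compact C -> connected C -> compact (h @` C) /\ connected (h @` C).
Proof.
move=> [_ _ _ ch _] Ch kC cC.
have cw : {within C, continuous h}.
  by apply: continuous_in_subspaceT => x /set_mem/Ch; exact: ch.
by split; [exact: continuous_compact|exact: connected_continuous_connected].
Qed.

End Pseudogroups.

Section Expansion.
Variables (R : realType) (X : topologicalType) (d : X -> X -> R).
Variable H : set (phomeo X X).
Hypothesis dm : topological_metric d.
Hypothesis pH : pseudogroup H.

Definition diam_ge (r : R) (C : set X) := exists x y, [/\ C x, C y & r <= d x y].
Definition diam_gt (r : R) (C : set X) := exists x y, [/\ C x, C y & r < d x y].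

Definition expands (delta : R) (hV : phomeo X X * set X) (E : set X) :=
  E `<=` hV.2 /\ diam_gt delta (hV.1 @` E).

(** The ultrafilter version of the compactness of the space of continua in K for
    the Vietoris topology: L consists of the points all of whose neighbourhoods
    are met by U-almost all E. The last two clauses say that U converges to L. *)
Lemma limit_continuum (U : set_system (set X)) (K : set X) (eps : R) :
  UltraFilter U -> compact K -> 0 < eps ->
  U [set E | [/\ E `<=` K, connected E & diam_ge eps E]] ->
  exists L, [/\ [/\ compact L, connected L & exists x y, [/\ L x, L y & x <> y]],
    L `<=` K,
    forall x V, L x -> nbhs x V -> U [set E | E `&` V !=set0] &
    forall O, open O -> L `<=` O -> U [set E | E `<=` O]].
Proof.
move=> UU cK eps0 UE.
have dec A : U A \/ U (~` A) := in_ultra_setVsetC A UU.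
have UP : ProperFilter U by exact: ultra_proper.
pose L := [set x : X | forall V, nbhs x V -> U [set E | E `&` V !=set0]].
have LK : L `<=` K.
  move=> x Lx; apply: contrapT => nKx.
  have /Lx UV : nbhs x (~` K).
    by apply: open_nbhs_nbhs; split=> //; apply: closed_openC; exact: (metric_compact_closed dm cK).
  have [E [[y [Ey nKy]] [EK _ _]]] := filter_ex (filterI UV UE).
  exact: nKy (EK _ Ey).
have cL : closed L.
  move=> x clx V; rewrite nbhsE => -[W [oW Wx] WV].
  have [y [Ly Wy]] := clx W (open_nbhs_nbhs (conj oW Wx)).
  have := Ly W (open_nbhs_nbhs (conj oW Wy)).
  by apply: filterS => E [z [Ez /WV Vz]]; exists z.
have kL : compact L by exact: subclosed_compact cK LK.
have LO O : open O -> L `<=` O -> U [set E | E `<=` O].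
  move=> oO LsO.
  suff UO : U [set E : set X | E `&` (K `&` ~` O) = set0].
    apply: filterS (filterI UO UE) => E [EKO [EK _ _]] y Ey.
    apply: contrapT => nOy; have : (E `&` (K `&` ~` O)) y.
      by split=> //; split=> //; exact: EK.
    by rewrite EKO.
  apply: (@compact_induction X (K `&` ~` O) (fun A => U [set E : set X | E `&` A = set0])).
  - by apply: compact_closedI => //; exact: open_closedC.
  - by apply: filterS filterT => E _ /=; rewrite setI0.
  - move=> A B UA UB; apply: filterS (filterI UA UB) => E [/= EA EB].
    by rewrite setIUr EA EB setU0.
  - move=> A B AB; apply: filterS => E /= EB; apply/seteqP; split=> // y [Ey Ay].
    by rewrite -EB; split=> //; exact: AB.
  - move=> x [Kx nOx]; have /existsNP[V /not_implyP[Vx nUV]] : ~ L x by move=> /LsO.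
    exists V => //; have [//|] := dec [set E | E `&` V !=set0].
    by apply: filterS => E /= /nonemptyPn.
have Lconn : connected L.
  apply: closed_connected => // P Q cP cQ PQ PQ0.
  apply: contrapT => /not_orP[/eqP/set0P[p Pp] /eqP/set0P[q Qq]].
  have cpt A : closed A -> A `<=` L -> compact A.
    by move=> cA AL; exact: subclosed_compact AL.
  have PL : P `<=` L by rewrite -PQ; exact: subsetUl.
  have QL : Q `<=` L by rewrite -PQ; exact: subsetUr.
  have [U1 [U2 [oU1 oU2 PU QU U120]]] :=
    separate_compact dm (cpt _ cP PL) (cpt _ cQ QL) PQ0.
  have E12 := LO _ (openU oU1 oU2).
  have {}E12 : U [set E | E `<=` U1 `|` U2].
    by apply: E12; rewrite -PQ => z [/PU|/QU]; [left|right].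
  have E1 := PL _ Pp _ (open_nbhs_nbhs (conj oU1 (PU _ Pp))).
  have E2 := QL _ Qq _ (open_nbhs_nbhs (conj oU2 (QU _ Qq))).
  have [E [[[[y [Ey U1y]] [z [Ez U2z]]] E12'] [_ cE _]]] :=
    filter_ex (filterI (filterI (filterI E1 E2) E12) UE).
  have := @connected_closed_split _ _ _ _ cE (open_closedC oU2) (open_closedC oU1).
  move=> /(_ _ _ _) h; suff /(_ z Ez) : E `<=` ~` U2 by [].
  apply: h.
  - move=> t /E12'[U1t|U2t]; [left|right] => Ut.
      by have : (U1 `&` U2) t by []; rewrite U120.
    by have : (U1 `&` U2) t by []; rewrite U120.
  - by apply/seteqP; split=> // t [[/E12'[]]].
  - by exists y; split=> // U2y; have : (U1 `&` U2) y by []; rewrite U120.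
have limpt (f : set X -> X) : U [set E | E (f E)] ->
    exists2 x, L x & forall V, nbhs x V -> U [set E | V (f E)].
  move=> Uf; have FP : ProperFilter (f @ U) by exact: fmap_proper_filter.
  have [|x [Kx clx]] := cK (f @ U) FP.
    by rewrite /fmap /=; apply: filterS (filterI Uf UE) => E [fE [EK _ _]]; exact: EK.
  have UV V : nbhs x V -> U [set E | V (f E)].
    move=> Vx; have [//|nUV] := dec [set E | V (f E)].
    have [y [/= nVy Vy]] := clx (~` V) V nUV Vx.
    by [].
  exists x => // V /UV UfV; apply: filterS (filterI Uf UfV) => E [/= ? ?].
  by exists (f E).
have /choice[xy Hxy] : forall E, exists xy : X * X,
    diam_ge eps E -> [/\ E xy.1, E xy.2 & eps <= d xy.1 xy.2].
  move=> E; have [[x [y Exy]]|nE] := pselect (diam_ge eps E); first by exists (x, y).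
  have [_ [_ _ [x _]]] := filter_ex UE.
  by exists (x, x).
have [|x Lx Vx] := limpt (fun E => (xy E).1).
  by apply: filterS UE => E [_ _ /Hxy[]].
have [|y Ly Vy] := limpt (fun E => (xy E).2).
  by apply: filterS UE => E [_ _ /Hxy[]].
exists L; split=> //; last by move=> z V; exact.
split=> //.
exists x, y; split=> // xEy.
have e20 : 0 < eps / 2 by lra.
have nx := Vx _ (dist_near dm x e20).
rewrite -xEy in Vy; have ny := Vy _ (dist_near dm x e20).
have [E [[/= d1 d2] [_ _ /Hxy[_ _ d3]]]] := filter_ex (filterI (filterI nx ny) UE).
have := dist_tri dm (xy E).1 x (xy E).2; rewrite (dist_sym dm (xy E).1 x); lra.
Qed.

(** If no finite family were enough, the continua escaping the finite families would
    generate a filter, and the limit of a finer ultrafilter would be enlarged by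
    some h together with the continua close to it. The set V attached to h keeps a
    definite distance from the part of K outside of the domain of h; being compact,
    it makes uniform estimates for h possible. *)
Lemma uniform_expansion (delta eps : R) (K : set X) : compact K -> 0 < eps ->
  (forall L, compact L -> connected L -> (exists x y, [/\ L x, L y & x <> y]) ->
     exists2 h, H h & L `<=` pdom h /\ diam_gt delta (h @` L)) ->
  exists S : set (phomeo X X * set X),
    [/\ finite_set S,
        forall hV, S hV -> [/\ H hV.1, compact hV.2 & hV.2 `<=` pdom hV.1] &
        forall E, connected E -> E `<=` K -> diam_ge eps E ->
          exists2 hV, S hV & expands delta hV E].
Proof.
move=> cK eps0 cw; apply: contrapT => nS.
pose good (S : set (phomeo X X * set X)) := finite_set S /\
  forall hV, S hV -> [/\ H hV.1, compact hV.2 & hV.2 `<=` pdom hV.1].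
pose bad (S : set (phomeo X X * set X)) : set (set X) :=
  [set E | [/\ E `<=` K, connected E & diam_ge eps E] /\
           forall hV, S hV -> ~ expands delta hV E].
have FF : ProperFilter (filter_from good bad).
  apply: filter_from_proper; last first.
    move=> S [fS gS]; apply: contrapT => /nonemptyPn b0; apply: nS.
    exists S; split=> // E cE EK Ed; apply: contrapT => nE.
    have : bad S E by split=> // hV ShV hVE; apply: nE; exists hV.
    by rewrite b0.
  apply: filter_from_filter.
    by exists set0; split=> //; exact: finite_set0.
  move=> S T [fS gS] [fT gT]; exists (S `|` T).
    by split; [rewrite finite_setU|move=> hV [/gS|/gT]].
  by move=> E [EK nE]; split; split=> // hV ?; apply: nE; [left|right].
have [U [UU FU]] := ultraFilterLemma FF.
have UE : U [set E | [/\ E `<=` K, connected E & diam_ge eps E]].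
  apply: FU; exists set0; last by move=> E [].
  by split=> //; exact: finite_set0.
have UP : ProperFilter U by exact: ultra_proper.
have [L [[kL cL nL] LK Lnear LO]] := limit_continuum UU cK eps0 UE.
have [h Hh [Lh [_ [_ [[x Lx <-] [y Ly <-] dxy]]]]] := cw L kL cL nL.
have ph := pseudogroup_phomeo pH Hh.
have [oh _ _ ch _] := ph.
have c1 : compact (K `&` ~` pdom h).
  by apply: compact_closedI => //; exact: open_closedC.
have [|eta eta0 Heta] := compact_gap dm kL c1.
  by apply/seteqP; split=> // z [/Lh ? []].
pose V := K `&` \bigcap_(y in K `&` ~` pdom h) [set z | eta / 2 <= d y z].
have gV : good [set (h, V)].
  split; first exact: finite_set1.
  move=> _ ->; split=> //=.
    apply: compact_closedI => //; apply: closed_bigI => z _.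
    exact: closed_dist_ge.
  move=> z [Kz Hz]; apply: contrapT => nhz.
  by have := Hz z (conj Kz nhz); rewrite /= dist_refl//; lra.
have UV : U [set E | E `<=` V].
  have oO : open (\bigcup_(l in L) [set t | d l t < eta / 2]).
    by apply: bigcup_open => l _; exact: open_dist_lt.
  have /(LO _ oO) UO : L `<=` \bigcup_(l in L) [set t | d l t < eta / 2].
    by move=> l Ll; exists l => //=; rewrite dist_refl//; lra.
  apply: filterS (filterI UO UE) => E [EO [EK _ _]] z Ez; split; first exact: EK.
  have [l Ll /= dlz] := EO z Ez.
  move=> t [Kt nht] /=; have := Heta l t Ll (conj Kt nht).
  by have := dist_tri dm l z t; rewrite (dist_sym dm z t); lra.
have Uxy : U [set E | diam_gt delta (h @` E)].
  have [[A B] /= [Ax By] HAB] := near_gt_dist dm dxy.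
  have Ux := Lnear x _ Lx (ch x (Lh x Lx) A Ax).
  have Uy := Lnear y _ Ly (ch y (Lh y Ly) B By).
  apply: filterS (filterI Ux Uy) => E [[x' [Ex' Ax']] [y' [Ey' By']]].
  exists (h x'), (h y'); split; [by exists x'|by exists y'|].
  exact: (HAB (h x', h y')).
have Ubad : U (bad [set (h, V)]) by apply: FU; exists [set (h, V)].
have [E [[EV Exy] [_ /(_ (h, V) erefl)]]] := filter_ex (filterI (filterI UV Uxy) Ubad).
exact.
Qed.

(** The pieces come from boundary bumping in the balls of radius delta / 4 around
    two points at distance more than delta. *)
Lemma split_continuum (delta : R) (J : set X) : 0 < delta ->
  compact J -> connected J -> diam_gt delta J ->
  exists D1 D2, [/\ compact D1 /\ compact D2, connected D1 /\ connected D2,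
    D1 `<=` J /\ D2 `<=` J, diam_ge (delta / 4) D1 /\ diam_ge (delta / 4) D2 &
    forall x y, D1 x -> D2 y -> delta / 2 <= d x y].
Proof.
move=> delta0 kJ cJ [p [q [Jp Jq dpq]]].
have piece s : J s -> ~ J `<=` [set t | d s t < delta / 4] ->
    exists D, [/\ compact D, connected D, D `<=` J, diam_ge (delta / 4) D &
      forall x, D x -> d s x <= delta / 4].
  move=> Js Jns.
  have [||D [kD cD DJ Ds Dn]] := boundary_bumping dm kJ cJ
     (open_dist_lt dm s (delta / 4)) (@closed_dist_le _ _ _ dm s (delta / 4)) _ Js _ Jns.
  - by move=> t /=; lra.
  - by rewrite /= dist_refl//; lra.
  exists D; split=> //; [by move=> t /DJ[]| |by move=> t /DJ[]].
  have /existsNP[t /not_implyP[Dt /= /negP nt]] := Dn.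
  by exists s, t; split=> //; rewrite leNgt.
have [|D1 [kD1 cD1 DJ1 dD1 D1p]] := piece p Jp.
  by move=> /(_ q Jq) /=; lra.
have [|D2 [kD2 cD2 DJ2 dD2 D2q]] := piece q Jq.
  by move=> /(_ p Jp) /=; rewrite (dist_sym dm); lra.
exists D1, D2; split=> // x y /D1p dx /D2q dy.
have := dist_tri dm p x q; have := dist_tri dm x y q.
by rewrite (dist_sym dm y q); lra.
Qed.

End Expansion.

(** * Horseshoes and entropy *)

Section Horseshoe.
Variables (R : realType) (X : topologicalType) (d : X -> X -> R).
Variables G H : set (phomeo X X).
Hypothesis dm : topological_metric d.
Hypothesis pH : pseudogroup H.
Hypothesis GH : generates G H.

(** One word moves x and y as f does; f itself may be glued from many words. *)
Definition tracked (f : X -> X) (N : nat) (x y : X) := exists w,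
  [/\ is_word G w, (size w <= N)%N,
      pdom (comp_word w) x /\ pdom (comp_word w) y &
      comp_word w x = f x /\ comp_word w y = f y].

Definition tracks (f : X -> X) (N : nat) (eps : R) (A : set X) :=
  forall x y, A x -> A y -> d x y <= eps -> tracked f N x y.

Lemma generated_tracked (h : phomeo X X) (Q : set X) :
  H h -> compact Q -> Q `<=` pdom h ->
  \forall p \near filter_prod ((0:R)^'+) \oo,
    forall x, Q x -> forall y, Q y -> d x y < p.1 -> tracked h p.2 x y.
Proof.
move=> Hh kQ Qh.
apply: (@lebesgue_near R X d dm nat \oo (fun N => tracked h N)) => // x Qx.
have [_ _ /(_ h Hh x (Qh x Qx))[U [w [oU Ux Uh Gw [Uw wh]]]]] := GH.
exists U; first exact: open_nbhs_nbhs.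
near=> N => y z Uy Uz; exists w; split=> //.
- by near: N; exact: nbhs_infty_ge.
- by split; exact: Uw.
- by split; rewrite -wh.
Unshelve. all: by end_near. Qed.

Lemma uniform_continuity (h : phomeo X X) (Q : set X) (e : R) : 0 < e ->
  is_phomeo h -> compact Q -> Q `<=` pdom h ->
  \forall p \near filter_prod ((0:R)^'+) \oo,
    forall x, Q x -> forall y, Q y -> d x y < p.1 -> d (h x) (h y) < e.
Proof.
move=> e0 ph kQ Qh.
apply: (@lebesgue_near R X d dm nat \oo (fun _ x y => d (h x) (h y) < e)) => // x Qx.
have [_ _ _ ch _] := ph.
have e20 : 0 < e / 2 by lra.
exists (h @^-1` [set t | d (h x) t < e / 2]).
  by apply: (ch x (Qh x Qx)); exact: dist_near.
apply: nearW => _ y z /= dy dz.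
by have := dist_tri dm (h y) (h x) (h z); rewrite (dist_sym dm (h y) (h x)); lra.
Qed.

Definition continuum (C : set X) := compact C /\ connected C.

Definition has_two_points (C : set X) := exists x y, [/\ C x, C y & x <> y].

(** Large continua, wherever they lie in X, have a piece that one of finitely many
    elements of H moves into a fixed compact set without shrinking it too much.
    This replaces the compactness of X. The sets B are closed in X so that
    their preimages in compact sets are compact. *)
Definition recurrent := forall rho : R, 0 < rho ->
  exists (S : set (phomeo X X * set X)) (K : set X) (eps : R),
  [/\ finite_set S, compact K, 0 < eps,
      forall eB, S eB -> [/\ H eB.1, closed eB.2 & eB.2 `<=` pdom eB.1] &
      forall C, continuum C -> diam_ge d rho C -> exists eB C',
        [/\ S eB, continuum C', C' `<=` C `&` eB.2, eB.1 @` C' `<=` K &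
            diam_ge d eps (eB.1 @` C')]].

Definition cw_constant (delta : R) := forall C, continuum C -> has_two_points C ->
  exists2 h, H h & C `<=` pdom h /\ diam_gt d delta (h @` C).

(** A state is a continuum enlarged by one of the finitely many maps h of
    [uniform_expansion]. Its image is cut into two distant continua, a piece of
    each of which is returned by some e from the recurrence; the transition is
    then f = e \o h. Only finitely many pairs (h, e) occur, each used on a compact
    set, which gives N and eps independent of the state. *)
Lemma horseshoe (delta : R) : 0 < delta -> cw_constant delta -> recurrent ->
  (exists2 C, continuum C & has_two_points C) ->
  exists (N : nat) (eps : R) (state : set (set X)),
  [/\ 0 < eps, exists E, state E, forall E, state E -> E !=set0 &
      forall E, state E -> exists E1 E2 f1 f2,
      [/\ E1 `<=` E /\ E2 `<=` E, forall x y, E1 x -> E2 y -> eps < d x y,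
          state (f1 @` E1) /\ state (f2 @` E2) &
          tracks f1 N eps E1 /\ tracks f2 N eps E2]].
Proof.
move=> delta0 cw rec [C0 cC0 nC0].
have d40 : 0 < delta / 4 by lra.
have d20 : 0 < delta / 2 by lra.
have [S1 [K [eps1 [fS1 kK eps10 gS1 rS1]]]] := rec _ d40.
have [|S2 [fS2 gS2 eS2]] := uniform_expansion dm pH (delta := delta) kK eps10.
  by move=> L kL cL nL; exact: cw.
pose state := [set E | continuum E /\ exists2 hV, S2 hV & expands d delta hV E].
have ret D : continuum D -> diam_ge d (delta / 4) D -> exists eB C',
    [/\ S1 eB, C' `<=` D `&` eB.2 & state (eB.1 @` C')].
  move=> cD dD; have [[e B] [C' [SeB [kC' cC'] C'D C'K dC']]] := rS1 D cD dD.
  exists (e, B), C'; split=> //.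
  have [/= He cB Be] := gS1 _ SeB.
  have [keC ceC] := phomeo_continuum (pseudogroup_phomeo pH He)
     (subset_trans C'D (subset_trans (@subIsetr _ _ _) Be)) kC' cC'.
  split; first by [].
  by have [hV ShV xhV] := eS2 _ ceC C'K dC'; exists hV.
(* The compact domain on which the transition from the state h to the return e is
   used. *)
pose Qs (q : (phomeo X X * set X) * (phomeo X X * set X)) :=
  q.1.2 `&` q.1.1 @^-1` q.2.2.
have Qok q : (S2 `*` S1) q ->
    compact (Qs q) /\ Qs q `<=` pdom (pcomp q.2.1 q.1.1).
  case: q => [[h V] [e B]] [/= /gS2[/= Hh kV Vh] /gS1[/= He cB Be]].
  have [_ _ _ ch _] := pseudogroup_phomeo pH Hh.
  split; last by move=> x [/= /Vh ? /Be ?].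
  apply: (subclosed_compact _ kV); last exact: subIsetl.
  move=> x clx; have Vx : V x.
    apply: (metric_compact_closed dm kV); apply: closure_subset clx; exact: subIsetl.
  split=> //; apply: cB => W Wx.
  have [z [[_ Bz] Wz]] := clx _ (ch x (Vh x Vx) W Wx).
  by exists (h z).
have N1 : \forall p \near filter_prod ((0:R)^'+) \oo,
    forall q, (S2 `*` S1) q -> forall x, Qs q x -> forall y, Qs q y ->
    d x y < p.1 -> tracked (pcomp q.2.1 q.1.1) p.2 x y.
  apply: near_finite_set; first exact: finite_setX.
  move=> q Sq; have [kq Qq] := Qok q Sq; apply: generated_tracked => //.
  by case: Sq => /gS2[? _ _] /gS1[? _ _]; exact: pseudogroup_comp.
have N2 : \forall p \near filter_prod ((0:R)^'+) \oo,
    forall hV, S2 hV -> forall x, hV.2 x -> forall y, hV.2 y ->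
    d x y < p.1 -> d (hV.1 x) (hV.1 y) < delta / 2.
  apply: near_finite_set => // hV /gS2[Hh kV Vh]; apply: uniform_continuity => //.
  exact: (pseudogroup_phomeo pH Hh).
have N0 : \forall p \near filter_prod ((0:R)^'+) \oo, 0 < p.1.
  exists ([set r | 0 < r], setT) => [|[r n] []//].
  by split=> /=; [exact: nbhs_right_gt|exact: filterT].
have [[r N] [[H1 H2] /= r0]] := filter_ex (filterI (filterI N1 N2) N0).
exists N, (r / 2), state; split.
- by lra.
- have [h Hh [C0h dh]] := cw C0 cC0 nC0.
  have [kD cD] := phomeo_continuum (pseudogroup_phomeo pH Hh) C0h cC0.1 cC0.2.
  have [|eB [C' [_ _ SC']]] := ret (h @` C0) (conj kD cD); last by exists (eB.1 @` C').
  by have [x [y [Cx Cy dxy]]] := dh; exists x, y; split=> //; lra.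
- by move=> E [_ [hV _ [_ [_ [_ [[x Ex _] _ _]]]]]]; exists x.
move=> E [[kE cE] [[h V] ShV [/= EV dE]]].
have [/= Hh kV Vh] := gS2 _ ShV.
have [kJ cJ] := phomeo_continuum (pseudogroup_phomeo pH Hh)
  (subset_trans EV Vh) kE cE.
have [D1 [D2 [[kD1 kD2] [cD1 cD2] [DJ1 DJ2] [dD1 dD2] D12]]] :=
  split_continuum dm delta0 kJ cJ dE.
have half D : D `<=` h @` E -> continuum D -> diam_ge d (delta / 4) D ->
    exists E' f, [/\ E' `<=` E, h @` E' `<=` D, state (f @` E') & tracks f N (r / 2) E'].
  move=> DJ cD dD; have [[e B] [C' [SeB C'D SC']]] := ret D cD dD.
  exists (E `&` h @^-1` C'), (e \o h); split.
  - exact: subIsetl.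
  - by move=> _ [x [_ /= /C'D[? _]] <-].
  - suff -> : (e \o h) @` (E `&` h @^-1` C') = e @` C' by [].
    apply/seteqP; split=> y [x].
      by move=> [Ex C'x] <-; exists (h x).
    move=> C'x <-; have [z Ez hz] := DJ _ (C'D _ C'x).1.
    by exists z; [split=> //=; rewrite hz|rewrite /= hz].
  - move=> x y [Ex /= C'x] [Ey /= C'y] dxy.
    apply: (H1 ((h, V), (e, B))) => //=; last by lra.
      by split; [exact: EV|exact: (C'D _ C'x).2].
    by split; [exact: EV|exact: (C'D _ C'y).2].
have [E1 [f1 [E1E hE1 sE1 tE1]]] := half D1 DJ1 (conj kD1 cD1) dD1.
have [E2 [f2 [E2E hE2 sE2 tE2]]] := half D2 DJ2 (conj kD2 cD2) dD2.
exists E1, E2, f1, f2; split=> // x y E1x E2y.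
(* The images under h are delta / 2 apart, so x and y cannot be r-close. *)
rewrite ltNge; apply/negP => dxy.
have := H2 _ ShV x (EV _ (E1E _ E1x)) y (EV _ (E2E _ E2y)).
have /= := D12 (h x) (h y) (hE1 _ (imageP _ E1x)) (hE2 _ (imageP _ E2y)).
move=> h1 h2; have : d x y < r by lra.
by move=> /h2 /=; lra.
Qed.

Definition word_separated (n : nat) (eps : R) (x y : X) := exists w,
  [/\ is_word G w, (size w <= n)%N, pdom (comp_word w) x, pdom (comp_word w) y &
      eps < d (comp_word w x) (comp_word w y)].

Lemma word_separated_sym n eps x y :
  word_separated n eps x y -> word_separated n eps y x.
Proof.
by move=> [w [Gw sw wx wy dxy]]; exists w; split=> //; rewrite dist_sym.
Qed.

Lemma word_separated0 n eps x y : eps < d x y -> word_separated n eps x y.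
Proof. by move=> dxy; exists [::]. Qed.

Lemma word_separated_track f N n eps x y : tracked f N x y ->
  word_separated n eps (f x) (f y) -> word_separated (N + n) eps x y.
Proof.
move=> [u [Gu su [ux uy] [fx fy]]] [w [Gw sw wx wy dxy]].
exists (w ++ u); split; first exact: is_word_cat.
- by rewrite size_cat addnC leq_add.
- by apply/(comp_word_cat w u x).1; rewrite fx.
- by apply/(comp_word_cat w u y).1; rewrite fy.
- by rewrite (comp_word_cat w u x).2 (comp_word_cat w u y).2 fx fy.
Qed.

(** By induction on n: a family for each of the two successors of a state is pulled
    back to the state. Points in the same half are either already eps-separated, or
    follow one common word before being separated by the induction hypothesis;
    points in different halves are separated from the start. *)
Lemma exponentially_many_separated (N : nat) (eps : R) (state : set (set X)) :
  (forall E, state E -> E !=set0) ->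
  (forall E, state E -> exists E1 E2 f1 f2,
      [/\ E1 `<=` E /\ E2 `<=` E, forall x y, E1 x -> E2 y -> eps < d x y,
          state (f1 @` E1) /\ state (f2 @` E2) &
          tracks f1 N eps E1 /\ tracks f2 N eps E2]) ->
  forall n E, state E -> exists (T : finType) (f : T -> X),
    [/\ #|T| = (2 ^ n)%N, forall t, E (f t) &
        forall s t, s != t -> word_separated (n * N) eps (f s) (f t)].
Proof.
move=> ne step; elim=> [|n IH] E SE.
  have [x Ex] := ne E SE; exists unit, (fun=> x); split=> //; exact: card_unit.
have [E1 [E2 [g1 [g2 [[E1E E2E] E12 [S1 S2] [t1 t2]]]]]] := step E SE.
have half E' g : state (g @` E') -> tracks g N eps E' ->
    exists (T : finType) (f : T -> X), [/\ #|T| = (2 ^ n)%N, forall t, E' (f t) &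
      forall s t, s != t -> word_separated (n.+1 * N) eps (f s) (f t)].
  move=> S' tr; have [T [f [cT Ef sf]]] := IH _ S'.
  have /choice[f' Hf'] : forall t, exists x, E' x /\ g x = f t.
    by move=> t; have [x ? ?] := Ef t; exists x.
  exists T, f'; split=> // [t|s t st]; first by case: (Hf' t).
  have [Es gs] := Hf' s; have [Et gt] := Hf' t.
  have [|lt] := leP (d (f' s) (f' t)) eps; last exact: word_separated0.
  move=> /(tr _ _ Es Et)/word_separated_track; rewrite mulSn; apply.
  by rewrite gs gt; exact: sf.
have [T1 [h1 [c1 Eh1 sh1]]] := half _ _ S1 t1.
have [T2 [h2 [c2 Eh2 sh2]]] := half _ _ S2 t2.
exists (T1 + T2)%type, (fun t => match t with inl t => h1 t | inr t => h2 t end).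
split.
- by rewrite card_sum c1 c2 addnn -mul2n expnS.
- by case=> t; [exact: E1E|exact: E2E].
- move=> [s|s] [t|t] st.
  + by apply: sh1; apply: contraNN st => /eqP ->.
  + by apply: word_separated0; exact: E12.
  + by apply/word_separated_sym/word_separated0; exact: E12.
  + by apply: sh2; apply: contraNN st => /eqP ->.
Qed.

End Horseshoe.

Section Entropy.
Variables (R : realType) (X : topologicalType) (d : X -> X -> R).
Variables G H : set (phomeo X X).
Local Open Scope ereal_scope.

Lemma sep_card_ge0 n (eps : R) : 0 <= sep_card d H G n eps.
Proof.
apply: ereal_sup_ubound; exists 0%N => //=.
by exists (fun i : 'I_0 => match i with Ordinal _ h => False_rect X (notF h) end); case.
Qed.

Lemma le_sep_card n (eps eps' : R) : (eps <= eps')%R ->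
  sep_card d H G n eps' <= sep_card d H G n eps.
Proof.
move=> ee; apply: le_ereal_sup => _ [k [f inj_f fk] <-]; exists k => //.
exists f => // i j ij; have [h Hh [hi hj lh sh]] := fk i j ij.
by exists h => //; split=> //; exact: le_lt_trans sh.
Qed.

Let rate (eps : R) n := (n%:R^-1)%:E * lne (sep_card d H G n eps).

Let le_rate n (eps eps' : R) : (eps <= eps')%R -> rate eps' n <= rate eps n.
Proof.
move=> ee; apply: lee_wpmul2l; first by rewrite lee_fin invr_ge0.
rewrite lee_lne ?in_itv/= ?sep_card_ge0 ?leey//.
exact: le_sep_card.
Qed.

Let le_limn_rate (eps eps' : R) : (eps <= eps')%R ->
  limn_esup (rate eps') <= limn_esup (rate eps).
Proof.
move=> ee; rewrite !limn_esup_lim; apply: lee_lim; [exact: is_cvg_esups..|].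
apply: nearW => k; apply: ge_ereal_sup => _ [n kn <-].
by apply: le_trans (le_rate n ee) _; apply: ereal_sup_ubound; exists n.
Qed.

(** The limit in eps is monotone, so any single eps bounds it from below; along the
    times k * N the exponential rate is at least ln 2 / N. *)
Lemma entropy_ge (N : nat) (eps : R) : (0 < N)%N -> (0 < eps)%R ->
  (forall n, (2 ^ n)%:R%:E <= sep_card d H G (n * N) eps) ->
  (ln 2 / N%:R)%:E <= entropy d H G.
Proof.
move=> N0 eps0 Hs; apply: lime_ge.
  apply: nonincreasing_at_right_is_cvge; apply: nearW => e x y _ _ xy.
  exact: le_limn_rate.
near=> e.
have ee : (e <= eps)%R by near: e; exact: nbhs_right_le.
apply: le_trans (le_limn_rate ee).
rewrite limn_esup_lim; apply: lime_ge; first exact: is_cvg_esups.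
apply: nearW => k.
apply: (@le_trans _ _ (rate eps (k.+1 * N)%N)); last first.
  apply: ereal_sup_ubound; exists (k.+1 * N)%N => //=.
  by rewrite (leq_trans (leqnSn k))// leq_pmulr.
apply: (@le_trans _ _ (((k.+1 * N)%:R^-1)%:E * lne ((2 ^ k.+1)%:R%:E))).
  rewrite lne_EFin ?ltr0n ?expn_gt0// -EFinM lee_fin natrX lnXn//.
  by rewrite -(mulr_natr (ln 2%R)) natrM invfM [leRHS]mulrC -[leRHS]mulrA mulVKf// pnatr_eq0.
apply: lee_wpmul2l; first by rewrite lee_fin invr_ge0.
by rewrite lee_lne ?in_itv/= ?sep_card_ge0 ?leey ?lee_fin ?ler0n//; exact: Hs.
Unshelve. all: by end_near. Qed.

End Entropy.

Lemma cw_expansive_entropy (R : realType) (X : topologicalType)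
    (d : X -> X -> R) (G H : set (phomeo X X)) :
  topological_metric d -> pseudogroup H -> recurrent d H ->
  (exists2 C : set X, continuum C & has_two_points C) ->
  cw_expansive d H -> generates G H -> (0 < entropy d H G)%E.
Proof.
move=> dm pH rec nC [delta delta0 cw] gG.
have GH : G `<=` H by case: gG.
have cwd : cw_constant d H delta.
  move=> C [kC cC] nonC; have [h Hh [Ch dh]] := cw C kC cC nonC.
  exists h => //; split=> //.
  have [_ [[x y] [Cx Cy] <-] dxy] := ereal_sup_gt dh.
  by exists x, y; split.
have [N [eps [state [eps0 [E SE] ne step]]]] := horseshoe dm pH gG delta0 cwd rec nC.
have step' E' : state E' -> exists E1 E2 f1 f2,
      [/\ E1 `<=` E' /\ E2 `<=` E', forall x y, E1 x -> E2 y -> eps < d x y,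
          state (f1 @` E1) /\ state (f2 @` E2) &
          tracks d G f1 N.+1 eps E1 /\ tracks d G f2 N.+1 eps E2].
  move=> /step[E1 [E2 [f1 [f2 [? ? ? [t1 t2]]]]]]; exists E1, E2, f1, f2; split=> //.
  have up f A : tracks d G f N eps A -> tracks d G f N.+1 eps A.
    move=> t x y Ax Ay /(t x y Ax Ay)[w [Gw sw ? ?]]; exists w; split=> //.
    exact: leqW.
  by split; exact: up.
have sep := exponentially_many_separated dm ne step'.
apply: (@lt_le_trans _ _ (ln 2 / N.+1%:R)%:E).
  by rewrite lte_fin divr_gt0// ln_gt0// ltr1n.
apply: (@entropy_ge _ _ _ _ _ _ eps) => // n.
have [T [f [cT _ sf]]] := sep n E SE.
apply: ereal_sup_ubound; exists #|T|; last by rewrite cT.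
exists (f \o enum_val).
  move=> i j /= fij; apply: enum_val_inj; apply/eqP; apply: contraPT isT => /sf.
  by rewrite fij => -[w [_ _ _ _]]; rewrite (dist_refl dm); lra.
move=> i j ij /=.
have [|w [Gw sw wi wj dw]] := sf (enum_val i) (enum_val j).
  by apply: contraNN ij => /eqP/enum_val_inj ->.
exists (comp_word w); first exact: (pseudogroup_word pH GH).
by split=> //; exists w; split=> //; split.
Qed.

(** * The complete transversal and its elementary holonomies *)

Section RowMatrices.
Variables (R : realType) (p q : nat).
Implicit Types (a : 'rV[R]_p) (c : 'rV[R]_q).

Lemma ball_row_mx a c a' c' (e : R) :
  ball a e a' -> ball c e c' -> ball (row_mx a c) e (row_mx a' c').
Proof.
move=> [e0 aa'] [_ cc']; split=> // i j.
by rewrite !mxE; case: (fintype.split j) => k.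
Qed.

Lemma ball_rsubmx (z z' : 'rV[R]_(p + q)) (e : R) :
  ball z e z' -> ball (rsubmx z) e (rsubmx z').
Proof. by move=> [e0 zz']; split=> // i j; rewrite !mxE. Qed.

Lemma cvg_row_mx (T : Type) (F : set_system T) (f : T -> 'rV[R]_p)
    (h : T -> 'rV[R]_q) a c : Filter F ->
  f @ F --> a -> h @ F --> c ->
  (fun t => row_mx (f t) (h t)) @ F --> row_mx a c.
Proof.
move=> FF fa hc A /nbhs_ballP[e /= e0 eA].
have Fa : F [set t | ball a e (f t)] := fa _ (nbhsx_ballx a e e0).
have Fc : F [set t | ball c e (h t)] := hc _ (nbhsx_ballx c e e0).
suff : F [set t | A (row_mx (f t) (h t))] by [].
apply: filterS (filterI Fa Fc) => t [/= ta tc]; apply: eA.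
exact: ball_row_mx.
Qed.

Lemma rsubmx_continuous : continuous (@rsubmx R 1 p q).
Proof.
move=> z A /nbhs_ballP[e /= e0 eA]; apply/nbhs_ballP; exists e => //= z' zz'.
by apply: eA; exact: ball_rsubmx.
Qed.

End RowMatrices.

Section PartialHomeo.
Variables (X Y : topologicalType) (h : phomeo X Y).
Hypothesis ph : is_phomeo h.

Lemma phomeo_bwdK x : pdom h x -> bwd h (h x) = x.
Proof. by case: ph => _ _ + _ _; apply. Qed.

Lemma phomeo_pran x : pdom h x -> pran h (h x).
Proof. by move=> hx; exists x. Qed.

Lemma phomeo_bwd_dom y : pran h y -> pdom h (bwd h y).
Proof. by case=> x hx <-; rewrite phomeo_bwdK. Qed.

Lemma phomeo_fwdK y : pran h y -> h (bwd h y) = y.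
Proof. by case=> x hx <-; rewrite phomeo_bwdK. Qed.

Lemma phomeo_near_dom x : pdom h x -> nbhs x (pdom h).
Proof. by move=> hx; apply: open_nbhs_nbhs; split=> //; case: ph. Qed.

Lemma phomeo_near_ran y : pran h y -> nbhs y (pran h).
Proof. by move=> hy; apply: open_nbhs_nbhs; split=> //; case: ph. Qed.

Lemma phomeo_cont x : pdom h x -> {for x, continuous h}.
Proof. by case: ph => _ _ _ + _; apply. Qed.

Lemma phomeo_bwd_cont y : pran h y -> {for y, continuous (bwd h)}.
Proof. by case: ph => _ _ _ _; apply. Qed.

End PartialHomeo.

Section Transversal.
Variables (R : realType) (p q : nat) (M : topologicalType).
Variables (I : finType) (xi : I -> phomeo M 'rV[R]_(p + q)).

Local Notation T := (complete_transversal xi).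

Definition position (t : T) : 'rV[R]_q := set_val (projT2 t).

Definition transversal_point i c (ic : plaque_space xi i c) : T :=
  existT _ i (exist _ c (mem_set ic)).

Lemma position_plaque_space (t : T) : plaque_space xi (projT1 t) (position t).
Proof. exact: set_valP. Qed.

Lemma transversal_eq (t u : T) :
  projT1 t = projT1 u -> position t = position u -> t = u.
Proof.
case: t u => i x [j y] /= ij; case: _ / ij y => y xy; congr existT.
exact: val_inj.
Qed.

(** The topology of the transversal in coordinates: the disjoint union of the
    Euclidean topologies of the plaque spaces. *)
Lemma transversal_nbhsP (t : T) (A : set T) : nbhs t A <->
  exists2 W, nbhs (position t) W &
    forall u, projT1 u = projT1 t -> W (position u) -> A u.
Proof.
case: t => i x.
have -> : nbhs (existT _ i x : T) A = nbhs x (existT _ i @^-1` A) by [].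
split.
  rewrite nbhsE => -[_ [[B oB <-] Bx] BA].
  exists B; first by apply: open_nbhs_nbhs; split.
  by move=> [j y] /= ji; subst j => By; exact: BA.
move=> [W Wx WA]; rewrite nbhsE in Wx; have [B [oB Bx] BW] := Wx.
rewrite nbhsE; exists (set_val @^-1` B).
  by split=> //; exists B.
by move=> y By; apply: WA => //; exact: BW.
Qed.

Lemma position_continuous : continuous position.
Proof. by move=> t A tA; apply/transversal_nbhsP; exists A. Qed.

Lemma transversal_closed i (B : set 'rV[R]_q) : closed B ->
  closed [set t : T | projT1 t = i /\ B (position t)].
Proof.
move=> cB t clt.
have [|u [[ui _] /= ut]] := clt [set u | projT1 u = projT1 t].
  by apply/transversal_nbhsP; exists setT; [exact: filterT|].
split; first by rewrite -ut.
apply: cB => W /position_continuous Wt.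
by have [v [[_ Bv] Wv]] := clt _ Wt; exists (position v).
Qed.

Lemma transversal_open i (B : set 'rV[R]_q) : open B ->
  open [set t : T | projT1 t = i /\ B (position t)].
Proof.
move=> oB; rewrite openE => t [ti Bt]; apply/transversal_nbhsP.
by exists B => [|u ut Bu]; [exact: open_nbhs_nbhs|split=> //; rewrite ut].
Qed.

End Transversal.

Section Holonomy.
Variables (R : realType) (p q : nat) (M : topologicalType).
Variable chart : M -> phomeo M 'rV[R]_(p + q).
Variable F : set (set M).
Variables (I : finType) (xi : I -> phomeo M 'rV[R]_(p + q)).
Hypothesis foliatedF : foliation chart 1 F.
Hypothesis nice : nice_atlas chart xi 1 F.

Local Notation T := (complete_transversal xi).
Local Notation dist := (distinguished chart 1 F).

Lemma nice_distinguished i : dist (xi i).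
Proof. by case: nice. Qed.

Lemma nice_phomeo i : is_phomeo (xi i).
Proof. by case: (nice_distinguished i). Qed.

Lemma nice_cover x : exists i, pdom (xi i) x.
Proof.
case: nice => _ cov _ _; have : [set: M] x by []; rewrite -cov => -[i _ ix].
by exists i.
Qed.

(** A plaque of the smaller domain is connected and lies in a leaf, so it is inside
    a single plaque of the larger domain. *)
Lemma same_plaque_sub (phi psi : phomeo M 'rV[R]_(p + q)) x y :
  dist phi -> dist psi -> pdom phi `<=` pdom psi ->
  pdom phi x -> pdom phi y -> rsubmx (phi x) = rsubmx (phi y) ->
  rsubmx (psi x) = rsubmx (psi y).
Proof.
move=> [_ _ comp1] [_ _ comp2] sub phix phiy xy.
have [L FL Lx] : exists2 L, F L & L x.
  by case: foliatedF => cov _ _ _; have : [set: M] x by []; rewrite -cov => -[L]; exists L.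
have [c1 Ec1] := comp1 L x FL Lx phix.
have [c2 Ec2] := comp2 L x FL Lx (sub _ phix).
have xx : connected_component (L `&` pdom phi) x x by exact: connected_component_refl.
have yx : connected_component (L `&` pdom phi) x y.
  by rewrite Ec1; split=> //; rewrite -xy; move: xx; rewrite Ec1 => -[].
have sub12 : connected_component (L `&` pdom phi) x `<=`
             connected_component (L `&` pdom psi) x.
  apply: connected_component_max => //; last exact: component_connected.
  by apply: subset_trans (@connected_component_sub _ _ _) _; exact: setIS.
by have := sub12 _ xx; have := sub12 _ yx; rewrite Ec2 => -[_ ->] [_ ->].
Qed.

Lemma nice_extension i j : pdom (xi i) `&` pdom (xi j) !=set0 ->
  exists2 psi, dist psi & closure (pdom (xi i) `|` pdom (xi j)) `<=` pdom psi /\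
                      forall x, pdom (xi i) x -> psi x = xi i x.
Proof. by case: nice => _ _ _; apply. Qed.

(** Niceness in the form that makes elementary holonomy single-valued: a plaque of
    the i-th domain meets at most one plaque of the j-th one. Both plaques extend to
    a plaque of a chart that contains the i-th domain and restricts to [xi j]. *)
Lemma same_plaque i j x y : pdom (xi i) x -> pdom (xi j) x ->
  pdom (xi i) y -> pdom (xi j) y ->
  rsubmx (xi i x) = rsubmx (xi i y) -> rsubmx (xi j x) = rsubmx (xi j y).
Proof.
move=> ix jx iy jy xy.
have [|psi dpsi [psicl psij]] := @nice_extension j i; first by exists x.
rewrite -!psij//; apply: (same_plaque_sub (nice_distinguished i)) => //.
by apply: subset_trans psicl => z iz; apply: subset_closure; right.
Qed.

(** The image of the plaque t among the plaques of the j-th domain. The source index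
    is recorded in t, so the same function serves as the backward map of
    [holonomy_map]. *)
Definition holonomy_image (j : I) (t : T) : T :=
  xget t [set u | projT1 u = j /\ plaque t `&` plaque u !=set0].

Definition holonomy_map (i j : I) : phomeo T T :=
  PHomeo [set t | projT1 t = i /\ plaque t `&` pdom (xi j) !=set0]
         (holonomy_image j) (holonomy_image i).

Lemma plaque_unique (t u u' : T) : projT1 u = projT1 u' ->
  plaque t `&` plaque u !=set0 -> plaque t `&` plaque u' !=set0 -> u = u'.
Proof.
move=> uu' [x [[tx xt] [ux xu]]] [y [[ty yt] [uy yu]]].
apply: transversal_eq => //; rewrite /position -xu -yu uu'.
apply: (@same_plaque (projT1 t)) => //; last by rewrite xt yt.
by rewrite -uu'.
Qed.

Lemma plaque_space_pos j x : pdom (xi j) x -> plaque_space xi j (rsubmx (xi j x)).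
Proof. by move=> jx; exists x. Qed.

Lemma holonomy_imageE j (t : T) x (jx : pdom (xi j) x) : plaque t x ->
  holonomy_image j t = transversal_point (plaque_space_pos jx).
Proof.
move=> tx; have meet : plaque t `&` plaque (transversal_point (plaque_space_pos jx)) !=set0.
  by exists x.
rewrite /holonomy_image; case: xgetP => [u -> [uj tu]|].
  exact: plaque_unique tu meet.
by move=> /(_ (transversal_point (plaque_space_pos jx)))[].
Qed.

(** Moving transversally from x at constant first coordinate reaches all the
    nearby plaques; with [slice_near] this gives openness and continuity of the
    elementary holonomies. *)
Lemma plaque_slice (t : T) x : plaque t x ->
  \forall u \near t, let y := bwd (xi (projT1 t))
      (row_mx (lsubmx (xi (projT1 t) x)) (position u)) in
    plaque u y.
Proof.
move=> [tx xt]; have ph := nice_phomeo (projT1 t).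
set a := lsubmx _.
have E : row_mx a (position t) = xi (projT1 t) x.
  by rewrite /a /position -xt hsubmxK.
have C : (fun u : T => row_mx a (position u)) @ t --> row_mx a (position t).
  by apply: cvg_row_mx; [exact: cvg_cst|exact: position_continuous].
have N : nbhs (row_mx a (position t)) (pran (xi (projT1 t))).
  by rewrite E; apply: phomeo_near_ran => //; exact: phomeo_pran.
have := C _ N; have : \forall u \near t, projT1 u = projT1 t.
  by apply/transversal_nbhsP; exists setT; [exact: filterT|].
apply: filterS2 => u /= ut ru.
set y := bwd _ _; suff : pdom (xi (projT1 u)) y /\ rsubmx (xi (projT1 u) y) = position u.
  by [].
rewrite ut; split; first exact: phomeo_bwd_dom.
by rewrite phomeo_fwdK// row_mxKr.
Qed.

Lemma slice_cvg (t : T) x : plaque t x ->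
  (fun u : T => bwd (xi (projT1 t))
      (row_mx (lsubmx (xi (projT1 t) x)) (position u))) @ t --> x.
Proof.
move=> [tx xt]; have ph := nice_phomeo (projT1 t).
set a := lsubmx _.
have E : row_mx a (position t) = xi (projT1 t) x.
  by rewrite /a /position -xt hsubmxK.
have C : (fun u : T => row_mx a (position u)) @ t --> row_mx a (position t).
  by apply: cvg_row_mx; [exact: cvg_cst|exact: position_continuous].
rewrite -[X in _ --> X](phomeo_bwdK ph tx) -E.
have B : {for row_mx a (position t), continuous (bwd (xi (projT1 t)))}.
  by apply: (phomeo_bwd_cont ph); rewrite E; exact: phomeo_pran.
by move=> A /B/C.
Qed.

Lemma slice_near (t : T) x (A : set M) : plaque t x -> nbhs x A ->
  \forall u \near t, A (bwd (xi (projT1 t))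
      (row_mx (lsubmx (xi (projT1 t) x)) (position u))).
Proof. by move=> tx /(slice_cvg tx). Qed.

Lemma holonomy_dom_open i j : open (pdom (holonomy_map i j)).
Proof.
rewrite openE => t /= [ti [x [tx jx]]].
have := plaque_slice tx; have := slice_near tx (phomeo_near_dom (nice_phomeo j) jx).
have : \forall u \near t, projT1 u = projT1 t.
  by apply/transversal_nbhsP; exists setT; [exact: filterT|].
apply: filterS3 => u ut /= jy uy; split; first by rewrite ut.
by eexists; split; [exact: uy|].
Qed.

Lemma holonomy_dom i j t : pdom (holonomy_map i j) t ->
  pdom (holonomy_map j i) (holonomy_image j t) /\
  holonomy_image i (holonomy_image j t) = t.
Proof.
move=> [/= ti [x [tx jx]]]; rewrite (holonomy_imageE jx tx).
have ix : pdom (xi i) x by rewrite -ti; case: tx.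
split; first by split=> //; exists x.
have -> := holonomy_imageE ix; last by split.
apply: transversal_eq => //; transitivity (rsubmx (xi i x)); first by [].
by rewrite -ti; case: tx.
Qed.

Lemma holonomy_ran i j : pran (holonomy_map i j) = pdom (holonomy_map j i).
Proof.
apply/seteqP; split=> u; first by move=> [t /holonomy_dom[+ _] <-].
by move=> /holonomy_dom[du E]; exists (holonomy_image i u).
Qed.

Lemma holonomy_image_cont i j t : pdom (holonomy_map i j) t ->
  {for t, continuous (holonomy_image j)}.
Proof.
move=> [/= ti [x [tx jx]]] A.
rewrite (holonomy_imageE jx tx) => /transversal_nbhsP[W Wx WA].
have phj := nice_phomeo j.
have Wx' : nbhs x [set y | W (rsubmx (xi j y))].
  have Wr : nbhs (rsubmx (xi j x)) W by [].
  exact: (phomeo_cont phj jx (rsubmx_continuous Wr)).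
suff : \forall u \near t, A (holonomy_image j u) by [].
have := plaque_slice tx.
have N : nbhs x (pdom (xi j) `&` [set y | W (rsubmx (xi j y))]).
  by apply: filterI => //; exact: phomeo_near_dom.
have := slice_near tx N.
apply: filterS2 => u /= [jy Wy] uy.
by rewrite (holonomy_imageE jy uy); apply: WA.
Qed.

Lemma holonomy_phomeo i j : is_phomeo (holonomy_map i j).
Proof.
split.
- exact: holonomy_dom_open.
- by rewrite holonomy_ran; exact: holonomy_dom_open.
- by move=> t /holonomy_dom[].
- by move=> t; exact: holonomy_image_cont.
- by move=> u; rewrite holonomy_ran; exact: holonomy_image_cont.
Qed.

Lemma holonomy_elementary i j : elementary_holonomy i j (holonomy_map i j).
Proof.
split; [exact: holonomy_phomeo|by []|move=> t [/= ti [x [tx jx]]]].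
by rewrite (holonomy_imageE jx tx); split=> //; exists x.
Qed.

(** Elementary holonomies between two given plaque spaces agree wherever their values
    are meaningful, so one representative for each pair is enough to form words. *)
Lemma elementary_holonomyE i j (h : phomeo T T) : elementary_holonomy i j h ->
  [/\ pdom h = pdom (holonomy_map i j), pran h = pran (holonomy_map i j),
      forall t, pdom h t -> h t = holonomy_map i j t &
      forall u, pran h u -> bwd h u = bwd (holonomy_map i j) u].
Proof.
move=> [ph dh eh].
have E t : pdom h t -> h t = holonomy_map i j t.
  move=> ht; have [jt mt] := eh t ht; rewrite dh in ht.
  have [_ _ /(_ t ht)[jt' mt']] := holonomy_elementary i j.
  by apply: plaque_unique mt mt'; rewrite jt jt'.
have Er : pran h = pran (holonomy_map i j).
  rewrite /pran /= -dh; apply/seteqP; split=> _ [t ht <-]; exists t => //.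
    by rewrite E.
  by rewrite E.
split=> // _ [t ht <-]; rewrite (phomeo_bwdK ph ht) E//.
by rewrite (phomeo_bwdK (holonomy_phomeo i j))//; move: ht; rewrite dh.
Qed.

Definition holonomy_generator : set (phomeo T T) :=
  [set holonomy_map ij.1 ij.2 | ij in
    [set ij | pdom (xi ij.1) `&` pdom (xi ij.2) !=set0]].

Lemma holonomy_finite_generator (H : set (phomeo T T)) :
  holonomy_pseudogroup xi H -> finite_generator holonomy_generator H.
Proof.
move=> [pH [EH cov gen]]; split.
  by apply: finite_image; exact: finite_finset.
split.
- move=> _ [[i j] /= ij <-]; apply: EH; exists i, j; split=> //.
  exact: holonomy_elementary.
- apply/seteqP; split=> // t _; have : [set: T] t by [].
  rewrite -cov => -[h [i [j [ij /elementary_holonomyE[dh rh _ _]]]] ht].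
  by exists (holonomy_map i j); [exists (i, j)|rewrite -dh -rh].
- have letter l : with_inverses (@elementary_holonomies _ _ _ _ _ xi) l ->
      exists2 l', with_inverses holonomy_generator l' & prestricts l l'.
    case=> [[i [j [ij /elementary_holonomyE[dh rh Eh _]]]]|
            [h [i [j [ij /elementary_holonomyE[dh rh _ Eh]]]] <-]].
      exists (holonomy_map i j); first by left; exists (i, j).
      by split; [rewrite dh|].
    exists (pinv (holonomy_map i j)).
      by right; exists (holonomy_map i j) => //; exists (i, j).
    by split=> /=; [rewrite rh|].
  have word w : is_word (@elementary_holonomies _ _ _ _ _ xi) w ->
      exists2 w', is_word holonomy_generator w' &
                  prestricts (comp_word w) (comp_word w').
    elim: w => [_|l w IH /is_word_cons[El Ew]]; first by exists [::].
    have [w' Gw' [dw Ew']] := IH Ew; have [l' Gl' [dl El']] := letter _ El.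
    exists (l' :: w'); first exact/is_word_cons.
    split=> /= [x [wx lx]|x [wx lx]].
      by split; [exact: dw|rewrite /= -Ew'//; exact: dl].
    by rewrite -Ew'// El'.
  move=> h Hh x hx; have [U [w [oU Ux Uh Ew [Uw wE]]]] := gen h Hh x hx.
  have [w' Gw' [dw Ew']] := word w Ew.
  exists U, w'; split=> //; split=> [y Uy|y Uy]; first exact/dw/Uw.
  by rewrite -Ew'; [exact: wE|exact: Uw].
Qed.

End Holonomy.

(** * Norms of row vectors, differentials and integrals *)

Section MatrixNorms.
Variable R : realType.

Lemma mx_norm_le m n (A : 'M[R]_(m, n)) (e : R) :
  0 <= e -> (forall i j, `|A i j| <= e) -> `|A| <= e.
Proof.
move=> e0 Ae; rewrite [leLHS]/Num.norm /= mx_normrE.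
by apply: bigmax_le => // ij _; exact: Ae.
Qed.

Lemma mx_entry_le m n (A : 'M[R]_(m, n)) i j : `|A i j| <= `|A|.
Proof.
rewrite [leRHS]/Num.norm /= mx_normrE.
exact: (@le_bigmax _ _ _ 0 (fun ij : 'I_m * 'I_n => `|A ij.1 ij.2|) (i, j)).
Qed.

Lemma norm_row_mx_le p q (a : 'rV[R]_p) (c : 'rV[R]_q) :
  `|row_mx a c| <= `|a| + `|c|.
Proof.
apply: mx_norm_le => [|i j]; first exact: addr_ge0.
rewrite mxE; case: (fintype.split j) => k.
  by apply: le_trans (mx_entry_le _ _ _) _; rewrite lerDl.
by apply: le_trans (mx_entry_le _ _ _) _; rewrite lerDr.
Qed.

Lemma quadratic_form_le n (w : 'rV[R]_n) (G : 'M[R]_n) :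
  `|(w *m G *m w^T) 0 0| <= n%:R ^+ 2 * `|G| * `|w| ^+ 2.
Proof.
have sumle (a : R) (f : 'I_n -> R) : (forall k, `|f k| <= a) ->
    `|\sum_k f k| <= n%:R * a.
  move=> fa; apply: le_trans (ler_norm_sum _ _ _) _.
  apply: (@le_trans _ _ (\sum_(k < n) a)); first exact: ler_sum.
  by rewrite sumr_const card_ord mulr_natl.
rewrite mxE.
suff -> : n%:R ^+ 2 * `|G| * `|w| ^+ 2 = n%:R * (n%:R * (`|w| * `|G|) * `|w|).
  apply: (@sumle _ _) => k; rewrite normrM; apply: ler_pM => //.
    rewrite mxE; apply: (@sumle _ _) => l.
    by rewrite normrM; apply: ler_pM => //; exact: mx_entry_le.
  by rewrite mxE; exact: mx_entry_le.
rewrite !expr2 !mulrA; congr (_ * _).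
by rewrite -!mulrA; congr (_ * (_ * _)); rewrite mulrC.
Qed.

Lemma sqrt_form_le n (w : 'rV[R]_n) (G : 'M[R]_n) (b r : R) :
  0 <= b -> 0 <= r -> `|G| <= b -> `|w| <= r ->
  Num.sqrt ((w *m G *m w^T) 0 0) <= n%:R * (b + 1) * r.
Proof.
move=> b0 r0 Gb wr; have L0 : 0 <= n%:R * (b + 1) * r.
  by rewrite !mulr_ge0// addr_ge0.
rewrite -[leRHS](ger0_norm L0) -sqrtr_sqr ler_sqrt ?sqr_ge0//.
apply: le_trans (ler_norm _) _; apply: le_trans (quadratic_form_le _ _) _.
rewrite !exprMn; apply: ler_pM; [by rewrite ?mulr_ge0 ?exprn_ge0..| |].
- by rewrite ler_wpM2l ?exprn_ge0//; apply: le_trans Gb _; nra.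
- by rewrite ler_sqr ?nnegrE.
Qed.

Lemma norm_diff_le n (W : normedModType R) (f : 'rV[R]_n -> W) x v (L : R) :
  differentiable f x -> (forall k, `|'D_(delta_mx 0 k) f x| <= L) ->
  `|'d f x v| <= n%:R * L * `|v|.
Proof.
move=> df fL; rewrite {1}(row_sum_delta v) linear_sum.
apply: le_trans (ler_norm_sum _ _ _) _.
apply: (@le_trans _ _ (\sum_(k < n) L * `|v|)); last first.
  by rewrite sumr_const card_ord -mulrA mulr_natl.
apply: ler_sum => k _; rewrite linearZ normrZ mulrC -deriveE//.
by apply: ler_pM => //; exact: mx_entry_le.
Qed.

(** The differential is a linear combination of the partial derivatives in the
    coordinate directions, which are continuous and hence locally bounded. *)
Lemma C1_diff_bounded n (W : normedModType R) (U : set 'rV[R]_n)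
    (f : 'rV[R]_n -> W) (x : 'rV[R]_n) : Ck 1 U f -> nbhs x U ->
  exists2 L, 0 <= L & \forall y \near x, forall v, `|'d f y v| <= L * `|v|.
Proof.
move=> [df Df] Ux; have xU := nbhs_singleton Ux.
pose l k := `|'D_(delta_mx 0 k) f x| + 1.
pose L := \sum_(k < n) l k.
have L0 : 0 <= L by apply: sumr_ge0 => k _; rewrite addr_ge0.
have le_L k : l k <= L.
  rewrite /L (bigD1 k)//= lerDl; apply: sumr_ge0 => j _.
  by rewrite addr_ge0.
exists (n%:R * L); first by rewrite mulr_ge0.
have near_le : \forall y \near x, forall k : 'I_n, `|'D_(delta_mx 0 k) f y| <= l k.
  have H k : [set: 'I_n] k -> \forall y \near x, `|'D_(delta_mx 0 k) f y| <= l k.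
    move=> _; have /cvgrPdist_le/(_ 1 ltr01) := Df (delta_mx 0 k) x xU.
    apply: filterS => y h; rewrite -lerBlDl.
    by apply: le_trans (lerB_dist _ _) _; rewrite distrC.
  have N : \forall y \near x, forall k : 'I_n, [set: 'I_n] k ->
      `|'D_(delta_mx 0 k) f y| <= l k.
    exact: (@near_finite_set _ _ [set: 'I_n] (nbhs x)
      (fun y k => `|'D_(delta_mx 0 k) f y| <= l k) _ finite_finset H).
  by apply: filterS N => y h k; exact: h.
apply: filterS2 near_le Ux => y Dy Uy v; apply: norm_diff_le; first exact: df.
by move=> k; apply: le_trans (le_L k).
Qed.

End MatrixNorms.

Section Rows.
Variables (R : realType) (p q : nat).

Let inl_mx (a : 'rV[R]_p) : 'rV[R]_(p + q) := row_mx a 0.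
Let inr_mx (c : 'rV[R]_q) : 'rV[R]_(p + q) := row_mx 0 c.

Let inl_linear : linear inl_mx.
Proof. by move=> k a b; rewrite /inl_mx scale_row_mx add_row_mx scaler0 addr0. Qed.

Let inr_linear : linear inr_mx.
Proof. by move=> k a b; rewrite /inr_mx scale_row_mx add_row_mx scaler0 addr0. Qed.

HB.instance Definition _ := GRing.isLinear.Build R 'rV[R]_p 'rV[R]_(p + q) _ inl_mx inl_linear.
HB.instance Definition _ := GRing.isLinear.Build R 'rV[R]_q 'rV[R]_(p + q) _ inr_mx inr_linear.

Let inl_cont : continuous inl_mx.
Proof. by move=> a; apply: (@cvg_row_mx _ _ _ _ (nbhs a) id (fun=> 0)) => //; exact: cvg_cst. Qed.

Let inr_cont : continuous inr_mx.
Proof. by move=> a; apply: (@cvg_row_mx _ _ _ _ (nbhs a) (fun=> 0) id) => //; exact: cvg_cst. Qed.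

Lemma is_diff_graph (sigma : 'rV[R]_q -> 'rV[R]_p) c : differentiable sigma c ->
  is_diff c (fun c => row_mx (sigma c) c) (fun v => row_mx ('d sigma c v) v).
Proof.
move=> ds.
have -> : (fun c => row_mx (sigma c) c) = (fun c => inl_mx (sigma c) + inr_mx c).
  by apply/funext => x; rewrite /inl_mx /inr_mx add_row_mx addr0 add0r.
have dl a := @linear_differentiable _ _ _ inl_mx a inl_cont.
have dr a := @linear_differentiable _ _ _ inr_mx a inr_cont.
have D1 : is_diff c (inl_mx \o sigma) (inl_mx \o 'd sigma c).
  apply: DiffDef; first exact: differentiable_comp.
  by rewrite (diff_comp ds (dl _)) (diff_lin _ inl_cont).
have D2 : is_diff c inr_mx inr_mx.
  by apply: DiffDef => //; rewrite (diff_lin _ inr_cont).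
have D3 := is_diffD D1 D2.
have -> : (fun v => row_mx ('d sigma c v) v) = (inl_mx \o 'd sigma c) + inr_mx.
  apply/funext => v.
  transitivity (row_mx ('d sigma c v) 0 + row_mx 0 v : 'rV[R]_(p + q)); last by [].
  by rewrite add_row_mx addr0 add0r.
by [].
Qed.

End Rows.

Section Integrals.
Variable R : realType.

(** The integral of a nonnegative function is a supremum over the simple functions
    below it, hence monotone on all functions. The speeds it is applied to are not
    shown to be measurable. *)
Lemma Rintegral_bounded (f : R -> R) (L : R) :
  (forall t, 0 <= t <= 1 -> 0 <= f t <= L) ->
  0 <= \int[lebesgue_measure]_(t in `[0, 1]) f t <= L.
Proof.
move=> fL; have L0 : 0 <= L.
  by have /andP[h1 h2] := fL 0 (introT andP (conj (lexx 0) ler01)); exact: le_trans h2.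
have E0 : (0 <= \int[@lebesgue_measure R]_(t in `[0%R, 1%R]) (f t)%:E)%E.
  by apply: integral_ge0 => t /=; rewrite in_itv /= lee_fin => /fL/andP[].
have E1 : (\int[@lebesgue_measure R]_(t in `[0%R, 1%R]) (f t)%:E <= L%:E)%E.
  have <- : (\int[@lebesgue_measure R]_(t in `[0%R, 1%R]) L%:E = L%:E)%E.
    by rewrite integral_cst//= lebesgue_measure_itv/= lte_fin ltr01 sube0 mule1.
  rewrite !ge0_integralE//; last first.
    by move=> t /=; rewrite in_itv /= lee_fin => /fL/andP[].
  apply: le_ereal_sup => _ [h hf <-]; exists h => //= t.
  apply: le_trans (hf t) _; rewrite /patch; case: ifPn => //.
  by rewrite inE /= in_itv /= lee_fin => /fL/andP[].
rewrite /Rintegral fine_ge0//= -lee_fin fineK//.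
by rewrite ge0_fin_numE//; apply: le_lt_trans E1 _; rewrite ltry.
Qed.

End Integrals.

(** * The Riemannian distance is Lipschitz in the coordinates *)

Section PlaqueSpaces.
Variables (R : realType) (p q : nat) (M : topologicalType).
Variable chart : M -> phomeo M 'rV[R]_(p + q).
Variable F : set (set M).
Variables (I : finType) (xi : I -> phomeo M 'rV[R]_(p + q)).
Hypothesis compactM : compact [set: M].
Hypothesis nice : nice_atlas chart xi 1 F.

Lemma plaque_space_ball i : exists (z : 'rV[R]_p) (a : 'rV[R]_q) (r : R),
  [/\ 0 < r, plaque_space xi i = ball a r &
      forall c, plaque_space xi i c -> pran (xi i) (row_mx z c)].
Proof.
have [_ _ /(_ i)[b [r [r0 E]]] _] := nice.
have box c : ball (rsubmx b) r c -> pran (xi i) (row_mx (lsubmx b) c).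
  move=> bc; rewrite E -[b in ball b]hsubmxK; apply: ball_row_mx => //.
  exact: ballxx.
have E' : plaque_space xi i = ball (rsubmx b) r.
  apply/seteqP; split=> [_ [x ix <-]|c /box[x ix xc]].
    by apply: ball_rsubmx; rewrite -E; exists x.
  by exists x => //; rewrite xc row_mxKr.
by exists (lsubmx b), (rsubmx b), r; split=> // c; rewrite E'; exact: box.
Qed.

Lemma plaque_space_open i : open (plaque_space xi i).
Proof. by have [z [a [r [r0 -> _]]]] := plaque_space_ball i; exact: ball_open. Qed.

Lemma plaque_space_convex i c c' (t : R) : plaque_space xi i c ->
  plaque_space xi i c' -> 0 <= t <= 1 -> plaque_space xi i (c + t *: (c' - c)).
Proof.
have [z [a [r [r0 -> _]]]] := plaque_space_ball i.
rewrite -!ball_normE /= => ac ac' /andP[t0 t1].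
have -> : a - (c + t *: (c' - c)) = (1 - t) *: (a - c) + t *: (a - c').
  by apply/matrixP => k l; rewrite !mxE; ring.
apply: le_lt_trans (ler_normD _ _) _; rewrite !normrZ !ger0_norm//; last by lra.
have [->|tn0] := eqVneq t 0; first by rewrite subr0 mul1r mul0r addr0.
have tp : 0 < t by rewrite lt_def tn0.
have h1 : (1 - t) * `|a - c| <= (1 - t) * r by apply: ler_wpM2l; [lra|exact: ltW].
have h2 : t * `|a - c'| < t * r by rewrite ltr_pM2l.
by apply: lt_le_trans (ler_ltD h1 h2) _; lra.
Qed.

Lemma closure_plaque_compact i : compact (closure (plaque_space xi i)).
Proof.
apply: bounded_closed_compact; last exact: closed_closure.
have [z [a [r [r0 -> _]]]] := plaque_space_ball i.
exists (`|a| + r + 1); split; first exact: num_real.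
move=> x xM y /= cly.
have [u [au yu]] := cly (ball y 1) (nbhsx_ballx y 1 ltr01).
move: au yu; rewrite -!ball_normE /= => au yu; apply: ltW.
apply: lt_trans xM; have -> : y = a - (a - u) + (y - u).
  by apply/matrixP => k l; rewrite !mxE; lra.
apply: le_lt_trans (ler_normD _ _) _; apply: ltr_leD; last exact: ltW.
apply: le_lt_trans (ler_normB _ _) _; rewrite ltrD2l//.
Qed.

(** Limits of a graph over the plaque space at the boundary of the cube. The point m
    is a cluster point in M of the points of the graph over c' as c' tends to c;
    any chart that extends [xi i] across the boundary sees it at the expected place. *)
Lemma closure_section i (sigma : 'rV[R]_q -> 'rV[R]_p) c :
  closure (plaque_space xi i) c -> {for c, continuous sigma} ->
  (forall c, plaque_space xi i c -> pran (xi i) (row_mx (sigma c) c)) ->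
  exists2 m, closure (pdom (xi i)) m &
    forall psi : phomeo M 'rV[R]_(p + q), is_phomeo psi ->
      closure (pdom (xi i)) `<=` pdom psi ->
      (forall x, pdom (xi i) x -> psi x = xi i x) -> psi m = row_mx (sigma c) c.
Proof.
move=> clc cs sr.
have ph : is_phomeo (xi i) by have [/(_ i)[]] := nice.
pose S c := bwd (xi i) (row_mx (sigma c) c).
pose N := within (plaque_space xi i) (nbhs c).
have PN : ProperFilter N by exact: within_nbhs_proper.
have PSN : ProperFilter (S @ N) by exact: fmap_proper_filter.
have [m [_ clm]] := compactM (F := S @ N) PSN filterT.
have inU : (S @ N) (pdom (xi i)).
  by rewrite /fmap /= /N /within /=; apply: nearW => c' ic'; apply: phomeo_bwd_dom => //; exact: sr.
have mcl : closure (pdom (xi i)) m by move=> V Vm; exact: clm.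
exists m => // psi ppsi cpsi psiE.
(* Neighbourhoods of psi m and of the expected value share a point of the graph. *)
apply: (@norm_hausdorff _ 'rV[R]_(p + q)) => A B Am Bc.
have Am' : nbhs m (psi @^-1` A) := phomeo_cont ppsi (cpsi _ mcl) Am.
have Bc' : (S @ N) [set x | exists c',
    [/\ plaque_space xi i c', x = S c' & B (row_mx (sigma c') c')]].
  rewrite /fmap /= /N /within /=.
  have C : (fun c' => row_mx (sigma c') c') @ c --> row_mx (sigma c) c.
    by apply: (@cvg_row_mx _ _ _ _ (nbhs c) sigma id _ _ _ cs).
  have CB : \forall c' \near c, B (row_mx (sigma c') c') := C _ Bc.
  apply: filterS CB => c' /= Bc' ic'.
  by exists c'.
have [_ [[c' [ic' -> Bc'']] As]] := clm _ _ Bc' Am'.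
exists (psi (S c')); split=> //.
rewrite psiE; last by apply: phomeo_bwd_dom => //; exact: sr.
by rewrite /S phomeo_fwdK//; exact: sr.
Qed.

End PlaqueSpaces.

Lemma image_nbhs (X Y : topologicalType) (psi : phomeo X Y) (A : set X) x :
  is_phomeo psi -> pdom psi x -> nbhs x A -> nbhs (psi x) (psi @` (A `&` pdom psi)).
Proof.
move=> ph hx Ax; have rx := phomeo_pran hx.
have Ax' : nbhs (bwd psi (psi x)) A by rewrite phomeo_bwdK.
apply: filterS2 (phomeo_near_ran ph rx) (phomeo_bwd_cont ph rx Ax') => y ry /= Ay.
by exists (bwd psi y); [split=> //; exact: phomeo_bwd_dom|rewrite phomeo_fwdK].
Qed.

Section Lipschitz.
Variables (R : realType) (p q : nat) (M : topologicalType).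
Variable chart : M -> phomeo M 'rV[R]_(p + q).
Variable g : M -> 'rV[R]_(p + q) -> 'M[R]_(p + q).
Variable F : set (set M).
Variables (I : finType) (xi : I -> phomeo M 'rV[R]_(p + q)).
Variable sigma : I -> 'rV[R]_q -> 'rV[R]_p.
Hypothesis closedM : closed_smooth_manifold chart.
Hypothesis metricM : riemannian_metric chart g.
Hypothesis nice : nice_atlas chart xi 1 F.
Hypothesis sections : transverse_sections xi sigma.

Let compactM : compact [set: M]. Proof. by case: closedM. Qed.

Lemma chart_phomeo x : is_phomeo (chart x) /\ pdom (chart x) x.
Proof. by case: closedM => /(_ 1%N)[]. Qed.

Lemma compat_differentiable (phi psi : phomeo M 'rV[R]_(p + q)) x :
  Ck_compatible 1 phi psi -> pdom phi x -> pdom psi x ->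
  differentiable (psi \o bwd phi) (phi x).
Proof. by move=> [[D _] _] phix psix; apply: D; exists x. Qed.

Lemma compat_differentiableV (phi psi : phomeo M 'rV[R]_(p + q)) x :
  Ck_compatible 1 phi psi -> pdom phi x -> pdom psi x ->
  differentiable (phi \o bwd psi) (psi x).
Proof. by move=> [_ [D _]] phix psix; apply: D; exists x. Qed.

(** The speed is defined in the chart attached to the current point of the curve;
    the transition rule of the metric evaluates it in any other chart around that
    point. *)
Lemma speed_chart i (c : R^o -> 'rV[R]_q) (t : R) m0 :
  let b := row_mx (sigma i (c t)) (c t) in
  let f0 := chart m0 \o bwd (xi i) in
  let w := 'd f0 b (row_mx ('d (sigma i) (c t) ('D_1 c t)) ('D_1 c t)) in
  plaque_space xi i (c t) -> differentiable c t -> differentiable (sigma i) (c t) ->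
  pdom (chart m0) (section xi sigma i (c t)) ->
  speed chart g (section xi sigma i \o c) t =
  Num.sqrt ((w *m g m0 (f0 b) *m w^T) 0 0).
Proof.
move=> b f0 w ict dc ds m0m.
have phi := nice_phomeo nice i.
have rb : pran (xi i) b by case: (sections i) => + _; apply.
pose m := section xi sigma i (c t).
have im : pdom (xi i) m by exact: phomeo_bwd_dom.
have xim : xi i m = b by exact: phomeo_fwdK.
have [phm mm] := chart_phomeo m; have [phm0 _] := chart_phomeo m0.
pose f := chart m \o bwd (xi i).
have [_ compat _] := nice_distinguished nice i.
have df : differentiable f b.
  by rewrite -xim; exact: compat_differentiableV.
have df0 : differentiable f0 b.
  by rewrite -xim; exact: compat_differentiableV.
have G := is_diff_graph ds.
set gr := (fun c => row_mx (sigma i c) c) in G.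
have dgr : differentiable gr (c t) by exact: ex_diff.
have Gv : forall v, 'd gr (c t) v = row_mx ('d (sigma i) (c t) v) v.
  by case: G => _ E v; rewrite E.
set u := row_mx ('d (sigma i) (c t) ('D_1 c t)) ('D_1 c t) in w *.
have Ev : 'D_1 (chart m \o (section xi sigma i \o c) : R^o -> _) t = 'd f b u.
  have -> : (chart m \o (section xi sigma i \o c)) = f \o (gr \o c) by [].
  have dgc : differentiable (gr \o c) t by exact: differentiable_comp.
  rewrite deriveE; last exact: differentiable_comp.
  rewrite diff_comp// diff_comp// /=; congr ('d f b _).
  by rewrite Gv /u deriveE.
pose h := chart m0 \o bwd (chart m).
have dh : differentiable h (chart m m).
  apply: compat_differentiable => //.
  by case: closedM => /(_ 1%N)[_ _ _ C] _ _ _; exact: C.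
have fb : f b = chart m m by [].
have Ew : w = 'd h (chart m m) ('d f b u).
  have E1 : 'D_u f0 b = 'D_u (h \o f) b.
    apply: near_eq_derive.
    have Nm : nbhs (bwd (xi i) b) (pdom (chart m)) by exact: phomeo_near_dom.
    have Nb : \forall y \near b, pdom (chart m) (bwd (xi i) y) :=
      phomeo_bwd_cont phi rb Nm.
    apply: filterS Nb => y /= my.
    by rewrite /f0 /h /f /= phomeo_bwdK.
  have dh' : differentiable h (f b) by rewrite fb.
  have dhf : differentiable (h \o f) b by exact: differentiable_comp.
  have E2 : w = 'D_u f0 b by exact: (esym (deriveE u df0)).
  have E3 : 'd (h \o f) b u = 'd h (f b) ('d f b u).
    exact: (congr1 (fun k => k u) (diff_comp df dh')).
  rewrite -fb.
  exact: (etrans E2 (etrans E1 (etrans (deriveE u dhf) E3))).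
rewrite /speed -/m Ev Ew.
case: metricM => _ _ _ /(_ m m0 m mm m0m)/(_ ('d f b u) ('d f b u)) MM.
exact: (congr1 (fun A : 'M[R]_1 => Num.sqrt (A 0 0)) MM).
Qed.

(** L bounds the operator norm at c0 of the derivative of the section, from the
    coordinate norm to the Riemannian one. *)
Definition speed_le i (L : R) c0 := forall (c : R^o -> 'rV[R]_q) (t : R),
  c t = c0 -> differentiable c t ->
  speed chart g (section xi sigma i \o c) t <= L * `|'D_1 c t|.

(** At a boundary point c0 of the cube, the chart psi extending [xi i] and a chart of
    M around the limit point m0 express the velocity through maps that are
    C^1 on a full neighbourhood, so their derivatives and the metric are bounded
    near c0; this is where the extension of sigma across the boundary enters. *)
Lemma local_speed_bound i c0 : closure (plaque_space xi i) c0 ->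
  exists2 L, 0 <= L &
    \forall c \near c0, plaque_space xi i c -> speed_le i L c.
Proof.
move=> clc0; have [sr [W [oW clW CW]]] := sections i.
have Wc0 : nbhs c0 W by apply: open_nbhs_nbhs; split=> //; exact: clW.
have phi := nice_phomeo nice i.
have ds c : W c -> differentiable (sigma i) c by case: CW => + _; apply.
have cs : {for c0, continuous (sigma i)}.
  by apply: differentiable_continuous; apply: ds; exact: clW.
have [m0 clm0 Em0] := closure_section compactM nice clc0 cs sr.
have nonempty : pdom (xi i) `&` pdom (xi i) !=set0.
  have [x [ix _]] := clm0 _ filterT; by exists x.
have [psi dpsi [clpsi psiE]] := nice_extension nice nonempty.
rewrite setUid in clpsi.
have [ppsi compat _] := dpsi.
pose b0 := row_mx (sigma i c0) c0.
have psim0 : psi m0 = b0 by exact: Em0.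
have psi0 : pdom psi m0 by exact: clpsi.
have [ph0 m00] := chart_phomeo m0.
pose A := chart m0 \o bwd psi.
pose U0 := psi @` (pdom (chart m0) `&` pdom psi).
have CA : Ck 1 U0 A by have [_ h] := compat m0.
have U0b : nbhs b0 U0.
  by rewrite -psim0; apply: image_nbhs => //; exact: phomeo_near_dom.
have [LA LA0 HA] := C1_diff_bounded CA U0b.
have [Ls Ls0 Hs] := C1_diff_bounded CW Wc0.
have Ab0 : A b0 = chart m0 m0 by rewrite /A /= -psim0 phomeo_bwdK.
have cA : {for b0, continuous A}.
  by apply: differentiable_continuous; case: CA => + _; apply; exact: nbhs_singleton.
have cg : {for b0, continuous (g m0 \o A)}.
  apply: continuous_comp => //; rewrite Ab0.
  by case: metricM => /(_ m0 0%N) /= + _ _ _; apply; exact: phomeo_pran.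
pose G0 := `|g m0 (A b0)| + 1.
have G00 : 0 <= G0 by rewrite addr_ge0.
have HG : \forall b \near b0, `|g m0 (A b)| <= G0.
  have /cvgrPdist_le/(_ 1 ltr01) := cg.
  apply: filterS => b h; rewrite -lerBlDl.
  by apply: le_trans (lerB_dist _ _) _; rewrite distrC.
pose gr := fun c => row_mx (sigma i c) c.
have Cgr : gr @ c0 --> b0 by apply: (@cvg_row_mx _ _ _ _ (nbhs c0) (sigma i) id).
have Hall : \forall b \near b0,
    [/\ U0 b, `|g m0 (A b)| <= G0 & forall v, `|'d A b v| <= LA * `|v|].
  by apply: filterS3 U0b HG HA => b *; split.
have Hc : \forall c \near c0, [/\ U0 (gr c), `|g m0 (A (gr c))| <= G0 &
    forall v, `|'d A (gr c) v| <= LA * `|v|] := Cgr _ Hall.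
pose n := (p + q)%N.
exists (n%:R * (G0 + 1) * LA * (Ls + 1)).
  by rewrite !mulr_ge0// addr_ge0.
apply: filterS3 Hc Hs Wc0 => c1 [U0c gc Ac] sc Wc ic c t ct dc; subst c1.
have rb : pran (xi i) (gr (c t)) by exact: sr.
have im := phomeo_bwd_dom phi rb; have xim := phomeo_fwdK phi rb.
set m := bwd (xi i) (gr (c t)) in im xim.
have psim : pdom psi m by apply: clpsi; exact: subset_closure.
have psiEm : psi m = gr (c t) by rewrite psiE.
have m0m : pdom (chart m0) m.
  have [m' [m0m' psim'] E] := U0c.
  by rewrite -(phomeo_bwdK ppsi psim) psiEm -E phomeo_bwdK.
pose v := 'D_1 c t; pose u : 'rV[R]_(p + q) := row_mx ('d (sigma i) (c t) v) v.
pose f0 := chart m0 \o bwd (xi i).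
have S := speed_chart ic dc (ds _ Wc) m0m.
rewrite -/f0 -/v -/u -/(gr (c t)) in S; rewrite -/v.
have near_f0 : \forall y \near gr (c t), f0 y = A y.
  apply: filterS (phomeo_near_ran phi rb) => _ [x ix <-].
  rewrite /f0 /A /= phomeo_bwdK// -psiE// phomeo_bwdK//.
  by apply: clpsi; exact: subset_closure.
have df0 : differentiable f0 (gr (c t)).
  rewrite -xim; apply: compat_differentiableV => //.
  by have [_ compati _] := nice_distinguished nice i.
have dA : differentiable A (gr (c t)) by case: CA => + _; apply.
have Ew : 'd f0 (gr (c t)) u = 'd A (gr (c t)) u.
  exact: (etrans (esym (deriveE u df0)) (etrans (near_eq_derive u near_f0) (deriveE u dA))).
have Ef : f0 (gr (c t)) = A (gr (c t)) by exact: nbhs_singleton near_f0.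
rewrite Ew Ef in S; rewrite {}S.
have uv : `|u| <= (Ls + 1) * `|v|.
  apply: le_trans (norm_row_mx_le _ _) _; rewrite mulrDl mul1r lerD2r.
  exact: sc.
have wv : `|'d A (gr (c t)) u| <= LA * ((Ls + 1) * `|v|) :=
  le_trans (Ac u) (ler_wpM2l LA0 uv).
have r0 : 0 <= LA * ((Ls + 1) * `|v|) :=
  mulr_ge0 LA0 (mulr_ge0 (addr_ge0 Ls0 ler01) (normr_ge0 v)).
have S := sqrt_form_le G00 r0 gc wv.
have -> : n%:R * (G0 + 1) * LA * (Ls + 1) * `|v| =
    n%:R * (G0 + 1) * (LA * ((Ls + 1) * `|v|)) by rewrite !mulrA.
exact: S.
Qed.

Lemma speed_bound i : exists2 L, 0 <= L &
  forall c, plaque_space xi i c -> speed_le i L c.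
Proof.
pose P (A : set 'rV[R]_q) := exists2 L, 0 <= L &
  forall c, A c -> plaque_space xi i c -> speed_le i L c.
suff [L L0 HL] : P (closure (plaque_space xi i)).
  by exists L => // c ic; apply: HL => //; exact: subset_closure.
apply: (compact_induction (closure_plaque_compact nice (i := i))).
- by exists 0.
- move=> A B [LA LA0 HA] [LB LB0 HB]; exists (LA + LB); first exact: addr_ge0.
  move=> c [Ac|Bc] ic z t zt dz.
    by apply: le_trans (HA c Ac ic z t zt dz) _; rewrite ler_wpM2r// lerDl.
  by apply: le_trans (HB c Bc ic z t zt dz) _; rewrite ler_wpM2r// lerDr.
- by move=> A B AB [L L0 HL]; exists L => // c /AB; exact: HL.
- move=> c0 /local_speed_bound[L L0 HL].
  by exists [set c | plaque_space xi i c -> speed_le i L c] => //; exists L.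
Qed.

Lemma line_diff (y v : 'rV[R]_q) (t : R) :
  is_diff t ((fun s => y + s *: v) : R^o -> _) ( *:%R ^~ v).
Proof.
have D := @is_diffD _ _ _ _ _ _ _ _ (is_diff_cst y (t : R^o)) (is_diff_scalel t v).
by rewrite add0r in D.
Qed.

Lemma line_derive (y v : 'rV[R]_q) (w t : R) :
  'D_w ((fun s => y + s *: v) : R^o -> _) t = w *: v.
Proof. by case: (line_diff y v t) => D E; rewrite deriveE// E. Qed.

Lemma line_C1 i (y z : 'rV[R]_q) : plaque_space xi i y -> plaque_space xi i z ->
  C1_curve xi i (fun s => y + s *: (z - y)).
Proof.
move=> iy iz; split; last by move=> t; exact: (plaque_space_convex nice).
exists setT; split=> //; first exact: openT.
split=> [t _|w t _]; first by case: (line_diff y (z - y) t).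
have -> : 'D_w ((fun s => y + s *: (z - y)) : R^o -> _) = (fun=> w *: (z - y)).
  by apply/funext => s; exact: line_derive.
exact: cst_continuous.
Qed.

Variable d : complete_transversal xi -> complete_transversal xi -> R.
Hypothesis td : transversal_dist chart xi sigma g d.

(** The straight segment from y to z stays in the cube, and its length is
    at most L times its coordinate length. *)
Lemma riemannian_dist_le i y z (L : R) : plaque_space xi i y -> plaque_space xi i z ->
  (forall c, plaque_space xi i c -> speed_le i L c) ->
  riemannian_dist chart xi sigma g i y z <= L * `|z - y|.
Proof.
move=> iy iz HL; pose c s := y + s *: (z - y).
have sp t : 0 <= t <= 1 -> 0 <= speed chart g (section xi sigma i \o c) t <= L * `|z - y|.
  move=> t01; rewrite sqrtr_ge0 /=.
  have ict : plaque_space xi i (c t) by exact: (plaque_space_convex nice).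
  case: (line_diff y (z - y) t) => D _.
  apply: le_trans (HL _ ict c t erefl D) _.
  by rewrite (line_derive y (z - y) 1 t) scale1r.
have /andP[_ cl] := Rintegral_bounded sp.
apply: le_trans cl; apply: ge_inf.
  exists 0 => _ [s _ <-]; apply: sumr_ge0 => e _.
  by apply: Rintegral_ge0 => t _; exact: sqrtr_ge0.
exists [:: c]; last by rewrite big_seq1.
split; [exact: line_C1|by rewrite /c scale0r addr0|].
by rewrite /= /c scale1r addrC subrK.
Qed.

Lemma dist_lipschitz : exists2 L, 0 <= L & forall s t,
  projT1 s = projT1 t -> d s t <= L * `|position t - position s|.
Proof.
have /choice[L HL] : forall i, exists L, 0 <= L /\
    forall c, plaque_space xi i c -> speed_le i L c.
  by move=> i; have [L] := speed_bound i; exists L.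
exists (\sum_i L i); first by apply: sumr_ge0 => i _; case: (HL i).
move=> [i y] [j z] /= ij; subst j.
case: td => _ -> _.
apply: le_trans (riemannian_dist_le _ _ (HL i).2) _; [exact: set_valP..|].
rewrite ler_wpM2r// (bigD1 i)//= lerDl; apply: sumr_ge0 => j _.
by case: (HL j).
Qed.

Lemma transversal_metric : topological_metric d.
Proof.
case: (td) => -[d0 dC dT] _ _; split=> // s e e0.
have [L L0 HL] := dist_lipschitz.
apply/transversal_nbhsP; exists (ball (position s) (e / (L + 1))).
  by apply: nbhsx_ballx; rewrite divr_gt0//; lra.
move=> t ts; rewrite -ball_normE /= => st.
apply: le_lt_trans (HL s t (esym ts)) _; rewrite distrC.
have L1 : 0 < L + 1 by lra.
have : (L + 1) * `|position s - position t| < e.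
  by rewrite mulrC -ltr_pdivlMr.
have := normr_ge0 (position s - position t); nra.
Qed.

End Lipschitz.

(** * Return of continua to a compact part of the transversal *)

Section Recurrence.
Variables (R : realType) (p q : nat) (M : topologicalType).
Variable chart : M -> phomeo M 'rV[R]_(p + q).
Variable F : set (set M).
Variables (I : finType) (xi : I -> phomeo M 'rV[R]_(p + q)).
Hypothesis compactM : compact [set: M].
Hypothesis foliatedF : foliation chart 1 F.
Hypothesis nice : nice_atlas chart xi 1 F.

Local Notation T := (complete_transversal xi).

(** [transversal_point] made into a total function of the coordinate, with the
    default value t0 off the plaque space. *)
Definition point_at (t0 : T) i (c : 'rV[R]_q) : T :=
  match pselect (plaque_space xi i c) with
  | left ic => transversal_point ic
  | right _ => t0
  end.

Lemma point_atE t0 i c : plaque_space xi i c ->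
  projT1 (point_at t0 i c) = i /\ position (point_at t0 i c) = c.
Proof. by rewrite /point_at; case: pselect. Qed.

Lemma point_at_cont t0 i c : plaque_space xi i c ->
  {for c, continuous (point_at t0 i)}.
Proof.
move=> ic A /transversal_nbhsP[W Wc WA].
have [pc posc] := point_atE t0 ic; rewrite posc in Wc.
have N : nbhs c (plaque_space xi i).
  by apply: open_nbhs_nbhs; split=> //; exact: (plaque_space_open nice).
suff : nbhs c [set c' | A (point_at t0 i c')] by [].
apply: filterS2 N Wc => c' ic' Wc'; have [pc' posc'] := point_atE t0 ic'.
by apply: WA; [rewrite pc' pc|rewrite posc'].
Qed.

Lemma closed_ball_compact (c : 'rV[R]_q) (r : R) : 0 < r ->
  compact [set c' | `|c - c'| <= r].
Proof.
move=> r0; have -> : [set c' | `|c - c'| <= r] = closed_ball c r.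
  by rewrite closed_ballE.
apply: bounded_closed_compact; last exact: closed_ball_closed.
exists (`|c| + r); split; first exact: num_real.
move=> x xM y; rewrite closed_ballE//= => cy; apply: ltW; apply: le_lt_trans xM.
have -> : y = c - (c - y) by rewrite subKr.
by apply: le_trans (ler_normB _ _) _; rewrite lerD2l.
Qed.

(** A chart that extends [xi i] across its boundary carries slices transverse to the
    leaves through the limit points of the i-th domain. If the limit point over c is
    in the j-th domain, the plaque of the slice point over c' in this domain depends
    continuously on c' in a full neighbourhood of c, and inside the i-th domain it
    is the elementary holonomy. It is injective because niceness puts the j-th domain
    inside that of the extending chart, so that two points of one plaque of the
    former are in one plaque of the latter. *)
Lemma extended_holonomy i c (r0 : R) : closure (plaque_space xi i) c -> 0 < r0 ->
  exists j r (f : 'rV[R]_q -> T), [/\ 0 < r <= r0,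
    pdom (xi i) `&` pdom (xi j) !=set0,
    forall c', `|c - c'| <= r -> {for c', continuous f},
    forall c1 c2, `|c - c1| <= r -> `|c - c2| <= r -> f c1 = f c2 -> c1 = c2 &
    forall t : T, projT1 t = i -> `|c - position t| <= r ->
      pdom (holonomy_map xi i j) t /\ holonomy_map xi i j t = f (position t)].
Proof.
move=> clc r00.
have [z [_ [_ [_ _ zi]]]] := plaque_space_ball nice i.
have [m clm Em] := closure_section compactM nice clc (@cst_continuous _ _ z c) zi.
have [j jm] := nice_cover nice m.
have phi := nice_phomeo nice i; have phj := nice_phomeo nice j.
have ij : pdom (xi i) `&` pdom (xi j) !=set0.
  by apply: clm; exact: phomeo_near_dom.
have [psi dpsi [clpsi psiE]] := nice_extension nice ij.
have ppsi : is_phomeo psi by case: dpsi.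
have subi : closure (pdom (xi i)) `<=` pdom psi.
  by apply: subset_trans clpsi; apply: closure_subset; exact: subsetUl.
have subj : pdom (xi j) `<=` pdom psi.
  by apply: subset_trans clpsi => x jx; apply: subset_closure; right.
have psim := Em psi ppsi subi psiE.
pose S (c' : 'rV[R]_q) := bwd psi (row_mx z c').
pose N := [set c' : 'rV[R]_q | pran psi (row_mx z c') /\ pdom (xi j) (S c')].
have rowC (c' : 'rV[R]_q) : (fun y => row_mx z y) @ c' --> row_mx z c'.
  by apply: (@cvg_row_mx _ _ _ _ (nbhs c') (fun=> z) id) => //; exact: cvg_cst.
have SC c' : N c' -> {for c', continuous S}.
  by move=> [rc' _] A /(phomeo_bwd_cont ppsi rc'); exact: rowC.
have rc : pran psi (row_mx z c) by rewrite -psim; exact/phomeo_pran/subi.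
have Sc : S c = m by rewrite /S -psim phomeo_bwdK//; exact: subi.
have Nc : nbhs c N.
  have N1 : \forall c' \near c, pran psi (row_mx z c').
    exact: rowC (phomeo_near_ran ppsi rc).
  have N2 : \forall c' \near c, pdom (xi j) (S c').
    have Nm : nbhs (S c) (pdom (xi j)) by rewrite Sc; exact: phomeo_near_dom.
    by apply: (SC c) => //; split=> //; rewrite Sc.
  by apply: filterS2 N1 N2 => c'; split.
have [r1 /= r10 r1N] := (nbhs_ballP _ _).1 Nc.
pose r := Num.min (r1 / 2) r0.
have r_gt0 : 0 < r by rewrite lt_min r00 andbT; lra.
have rN c' : `|c - c'| <= r -> N c'.
  move=> cc'; apply: r1N; rewrite -ball_normE /=; apply: le_lt_trans cc' _.
  by rewrite gt_min; apply/orP; left; lra.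
have T0 : T := transversal_point (plaque_space_pos jm).
pose Psi c' := point_at T0 j (rsubmx (xi j (S c'))).
have pos c' : N c' -> plaque_space xi j (rsubmx (xi j (S c'))).
  by move=> [_ jS]; exact: plaque_space_pos.
exists j, r, Psi; split=> //.
- by rewrite r_gt0 ge_min lexx orbT.
- move=> c' /rN Nc' A /(point_at_cont (pos _ Nc'))/rsubmx_continuous.
  by move=> /(phomeo_cont phj Nc'.2)/(SC _ Nc').
- move=> c1 c2 /rN N1 /rN N2 E.
  have /(congr1 (fun t => position t)) := E.
  rewrite (point_atE T0 (pos _ N1)).2 (point_atE T0 (pos _ N2)).2 => E12.
  have := same_plaque_sub foliatedF (nice_distinguished nice j) dpsi subj N1.2 N2.2 E12.
  by rewrite /S !phomeo_fwdK//; [rewrite !row_mxKr|case: N2|case: N1].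
- move=> t ti /rN Nt.
  have it : plaque_space xi i (position t).
    by rewrite -ti; exact: position_plaque_space.
  have rt := zi _ it.
  have iS := phomeo_bwd_dom phi rt; have xiS := phomeo_fwdK phi rt.
  have ES : S (position t) = bwd (xi i) (row_mx z (position t)).
    by rewrite /S -{1}xiS -psiE// phomeo_bwdK//; exact/subi/subset_closure.
  have tS : plaque t (S (position t)).
    rewrite ES; suff : pdom (xi (projT1 t)) (bwd (xi i) (row_mx z (position t))) /\
      rsubmx (xi (projT1 t) (bwd (xi i) (row_mx z (position t)))) = position t by [].
    by rewrite ti xiS row_mxKr.
  split; first by split=> //; exists (S (position t)); split=> //; case: Nt.
  rewrite /= (holonomy_imageE foliatedF nice Nt.2 tS).
  by have [h1 h2] := point_atE T0 (pos _ Nt); apply: transversal_eq; rewrite ?h1 ?h2.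
Qed.

Variable d : T -> T -> R.
Variable H : set (phomeo T T).
Hypothesis dm : topological_metric d.
Hypothesis holH : holonomy_pseudogroup xi H.
Variable L : R.
Hypothesis L0 : 0 <= L.
Hypothesis lip : forall s t : T,
  projT1 s = projT1 t -> d s t <= L * `|position t - position s|.

(** [recurrent] at scale rho for the continua that meet A, a property of A to which
    [compact_induction] applies. *)
Definition returns_from (rho : R) (A : set T) :=
  exists (S : set (phomeo T T * set T)) (K : set T) (eps : R),
  [/\ finite_set S, compact K, 0 < eps,
      forall eB, S eB -> [/\ H eB.1, closed eB.2 & eB.2 `<=` pdom eB.1] &
      forall C, continuum C -> diam_ge d rho C -> C `&` A !=set0 ->
        exists eB C', [/\ S eB, continuum C', C' `<=` C `&` eB.2,
          eB.1 @` C' `<=` K & diam_ge d eps (eB.1 @` C')]].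

Lemma returns_from0 rho : returns_from rho set0.
Proof.
exists set0, set0, 1; split=> //; first exact: compact0.
by move=> C _ _; rewrite setI0 => -[].
Qed.

Lemma returns_fromU rho A B :
  returns_from rho A -> returns_from rho B -> returns_from rho (A `|` B).
Proof.
move=> [S1 [K1 [e1 [fS1 cK1 e10 gS1 H1]]]] [S2 [K2 [e2 [fS2 cK2 e20 gS2 H2]]]].
exists (S1 `|` S2), (K1 `|` K2), (Num.min e1 e2); split.
- by rewrite finite_setU.
- exact: compactU.
- by rewrite lt_min e10.
- by move=> eB [/gS1|/gS2].
- move=> C cC dC; rewrite setIUr => -[x [Ax|Bx]].
  + have [|eB [C' [SeB cC' C'C C'K [y [z [Cy Cz yz]]]]]] := H1 C cC dC; first by exists x.
    exists eB, C'; split=> //; [by left|by move=> u /C'K; left|].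
    by exists y, z; split=> //; apply: le_trans yz; rewrite ge_min lexx.
  + have [|eB [C' [SeB cC' C'C C'K [y [z [Cy Cz yz]]]]]] := H2 C cC dC; first by exists x.
    exists eB, C'; split=> //; [by right|by move=> u /C'K; right|].
    by exists y, z; split=> //; apply: le_trans yz; rewrite ge_min lexx orbT.
Qed.

Lemma returns_fromS rho A B : A `<=` B -> returns_from rho B -> returns_from rho A.
Proof.
move=> AB [S [K [e [fS cK e0 gS HS]]]]; exists S, K, e; split=> // C cC dC [x [Cx Ax]].
by apply: HS => //; exists x; split=> //; exact: AB.
Qed.

(** The ball of radius r around c is too small to contain a continuum of diameter
    rho. By boundary bumping a continuum that meets the ball of radius r / 2 contains
    a continuum joining it to the sphere of radius r within the closed ball. The
    extended holonomy is injective there, so the images of the half ball and of the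
    sphere are disjoint compact sets, and their distance bounds the size of the
    image of the continuum from below. *)
Lemma local_return (rho : R) i c : 0 < rho -> closure (plaque_space xi i) c ->
  exists2 V, nbhs c V & returns_from rho [set t | projT1 t = i /\ V (position t)].
Proof.
move=> rho0 clc; have Lge0 := L0.
have L4 : 0 < 4 * (L + 1) by lra.
have r00 : 0 < rho / (4 * (L + 1)) by exact: divr_gt0.
have [j [r [psi [/andP[r_gt0 rr0] ij cpsi ipsi Epsi]]]] := extended_holonomy clc r00.
have r20 : 0 < r / 2 by lra.
have smallr : L * (2 * r) < rho.
  have : (L + 1) * (4 * r) <= rho.

    by move: rr0; rewrite (ler_pdivlMr _ _ L4) => h; nra.
  nra.
exists (ball c (r / 2)); first exact: nbhsx_ballx.
pose D := [set c' : 'rV[R]_q | `|c - c'| <= r].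
have cptimg (A : set 'rV[R]_q) : compact A -> A `<=` D -> compact (psi @` A).
  move=> cA AD; apply: continuous_compact => //.
  by apply: continuous_in_subspaceT => x /set_mem/AD; exact: cpsi.
have cD : compact D by exact: closed_ball_compact.
have subD : [set c' : 'rV[R]_q | `|c - c'| <= r / 2] `<=` D.
  by move=> x xr; apply: le_trans xr _; lra.
have cP1 := cptimg _ (@closed_ball_compact c _ r20) subD.
have cS : compact (D `&` ~` ball c r).
  by apply: compact_closedI => //; apply: open_closedC; exact: ball_open.
have cP2 := cptimg _ cS (@subIsetl _ _ _).
have [|eps eps0 Heps] := compact_gap dm cP1 cP2.
  apply/seteqP; split=> // _ [[x /= xr <-] [y [Dy ny] yx]].
  have Dx : D x by exact: subD.
  apply: ny; rewrite -(ipsi _ _ Dx Dy (esym yx)) -ball_normE /=.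
  by apply: le_lt_trans xr _; lra.
pose e := holonomy_map xi i j.
pose B := [set t : T | projT1 t = i /\ D (position t)].
pose U := [set t : T | projT1 t = i /\ ball c r (position t)].
have cB : closed B.
  apply: transversal_closed; have -> : D = closed_ball c r by rewrite closed_ballE.
  exact: closed_ball_closed.
have oU : open U by apply: transversal_open; exact: ball_open.
have UB : U `<=` B by move=> t [ti]; rewrite -ball_normE /= => /ltW.
have Be : B `<=` pdom e by move=> t [ti Dt]; have [] := Epsi t ti Dt.
have He : H e.
  case: holH => _ [+ _ _]; apply; exists i, j; split=> //.
  exact: (holonomy_elementary foliatedF nice).
exists [set (e, B)], (psi @` D), eps; split=> //.
- exact: cptimg.
- by move=> _ ->.
move=> C [kC cC] [s [t [Cs Ct st]]] [x [Cx [xi_ xV]]].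
have Ux : U x by split=> //; apply: le_ball xV; lra.
have nCU : ~ C `<=` U.
  move=> CU; have [si] := CU s Cs; have [ti] := CU t Ct.
  rewrite -!ball_normE /= => tc sc.
  have := lip (etrans si (esym ti)).
  have : `|position t - position s| <= 2 * r.
    have -> : position t - position s = (c - position s) - (c - position t).
      by apply/matrixP => k l; rewrite !mxE; ring.
    by apply: le_trans (ler_normB _ _) _; lra.
  by have := normr_ge0 (position t - position s); nra.
have [C' [kC' cC' C'C C'x /existsNP[y /not_implyP[C'y nUy]]]] :=
  boundary_bumping dm kC cC oU cB UB Cx Ux nCU.
have [yi Dy] : B y by have [] := C'C _ C'y.
have [_ Ex] := Epsi x xi_ (UB _ Ux).2.
have [_ Ey] := Epsi y yi Dy.
exists (e, B), C'; split=> //=.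
- move=> _ [u /C'C[_ [ui Du]] <-]; have [_ Eu] := Epsi u ui Du.
  by exists (position u) => //; exact: esym Eu.
- exists (e x), (e y); split; [by exists x|by exists y|].
  have : eps <= d (psi (position x)) (psi (position y)); last by rewrite -Ex -Ey.
  apply: Heps; [exists (position x)|exists (position y)] => //.
    by move: xV; rewrite -ball_normE /= => /ltW.
  by split=> // by_; apply: nUy.
Qed.

Lemma holonomy_recurrent : recurrent d H.
Proof.
move=> rho rho0; suff : returns_from rho [set: T].
  move=> [S [K [eps [fS cK eps0 gS HS]]]]; exists S, K, eps; split=> // C cC dC.
  by apply: HS => //; have [x [_ [Cx _ _]]] := dC; exists x.
have piece i : returns_from rho [set t | projT1 t = i].
  apply: (@returns_fromS _ _ [set t | projT1 t = i /\ closure (plaque_space xi i) (position t)]).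
    move=> t ti; split=> //; apply: subset_closure; rewrite -[i]ti.
    exact: position_plaque_space.
  apply: (@compact_induction _ _
    (fun A => returns_from rho [set t | projT1 t = i /\ A (position t)])
    (closure_plaque_compact nice (i := i))).
  - by apply: returns_fromS (returns_from0 rho) => t [].
  - move=> A B PA PB; apply: returns_fromS (returns_fromU PA PB).
    by move=> t [ti [At|Bt]]; [left|right].
  - by move=> A B AB; apply: returns_fromS => t [ti /AB].
  - by move=> c; exact: local_return.
suff all (s : seq I) : returns_from rho [set t | projT1 t \in s].
  by apply: returns_fromS (all (enum I)) => t _ /=; rewrite mem_enum.
elim: s => [|i s IH]; first by apply: returns_fromS (returns_from0 rho) => t.
apply: returns_fromS (returns_fromU (piece i) IH) => t /=.
by rewrite inE => /orP[/eqP|]; [left|right].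
Qed.

End Recurrence.

(** A segment in a cube; positive codimension provides two distinct end points. *)
Lemma transversal_continuum (R : realType) (p q : nat) (M : topologicalType)
    (chart : M -> phomeo M 'rV[R]_(p + q)) (F : set (set M))
    (I : finType) (xi : I -> phomeo M 'rV[R]_(p + q)) :
  [set: M] !=set0 -> nice_atlas chart xi 1 F -> (0 < q)%N ->
  exists2 C : set (complete_transversal xi), continuum C & has_two_points C.
Proof.
move=> [x _] nice q0; have [i ix] := nice_cover nice x.
have [_ [a [r [r0 E _]]]] := plaque_space_ball nice i.
pose v : 'rV[R]_q := const_mx (r / 2).
have ia : plaque_space xi i a by rewrite E; exact: ballxx.
have iv : plaque_space xi i (a + v).
  rewrite E -ball_normE /= opprD addNKr normrN.
  apply: (@le_lt_trans _ _ (r / 2)); last by lra.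
  have r20 : 0 <= r / 2 by lra.
  by apply: mx_norm_le => // k l; rewrite mxE ger0_norm.
pose t0 := transversal_point ia.
pose f (s : R) := point_at t0 i (a + s *: ((a + v) - a)).
have line s : 0 <= s <= 1 -> plaque_space xi i (a + s *: ((a + v) - a)).
  exact: (plaque_space_convex nice).
have cf : {within `[0, 1], continuous f}.
  apply: continuous_in_subspaceT => s /set_mem; rewrite /= in_itv /= => s01.
  apply: (@continuous_comp _ _ _ (fun s : R => a + s *: ((a + v) - a)) (point_at t0 i)).
    apply: differentiable_continuous; case: (line_diff a ((a + v) - a) s) => D _.
    exact: D.
  by apply: (point_at_cont nice); exact: line.
exists (f @` `[0, 1]).
  split; first by apply: continuous_compact => //; exact: segment_compact.
  by apply: connected_continuous_connected => //; exact: segment_connected.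
exists (f 0), (f 1); split; [exists 0|exists 1|] => //=; rewrite ?in_itv /= ?lexx ?ler01//.
move/(congr1 (fun t => position t)); rewrite /f.
rewrite (point_atE t0 (line 0 _)).2 ?lexx ?ler01// (point_atE t0 (line 1 _)).2 ?lexx ?ler01//.
rewrite scale0r scale1r addr0 addrC subrK => /matrixP/(_ 0 (Ordinal q0)).
by rewrite !mxE; lra.
Qed.

Theorem corollary3 (R : realType) (p q : nat) (M : topologicalType)
    (chart : M -> phomeo M 'rV[R]_(p + q))
    (g : M -> 'rV[R]_(p + q) -> 'M[R]_(p + q))
    (F : set (set M))
    (I : finType) (xi : I -> phomeo M 'rV[R]_(p + q))
    (sigma : I -> 'rV[R]_q -> 'rV[R]_p)
    (d : complete_transversal xi -> complete_transversal xi -> R)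
    (H : set (phomeo (complete_transversal xi) (complete_transversal xi))) :
  closed_smooth_manifold chart ->
  riemannian_metric chart g ->
  foliation chart 1 F ->
  (0 < q)%N ->
  nice_atlas chart xi 1 F ->
  transverse_sections xi sigma ->
  transversal_dist chart xi sigma g d ->
  holonomy_pseudogroup xi H ->
  cw_expansive d H ->
  positive_entropy d H.
Proof.
move=> closedM metricM foliatedF q0 nice sections td holH cw.
have [_ compactM _ neM] := closedM.
have dm := transversal_metric closedM metricM nice sections td.
have [L L0 lip] := dist_lipschitz closedM metricM nice sections td.
have rec := holonomy_recurrent compactM foliatedF nice dm holH L0 lip.
split.
  exists (@holonomy_generator _ _ _ _ _ xi).
  exact: (holonomy_finite_generator foliatedF nice).
move=> G [_ genG]; have [pH _] := holH.
apply: cw_expansive_entropy dm pH rec _ cw genG.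
exact: transversal_continuum neM nice q0.
Qed.
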